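(* Let $n\ge 0$ be an integer, let $\sigma$ be a real number, let $\beta\ge 0$ be a real number with $\beta\neq 1$, let $0\le\gamma<1$, and let $c>-1$ be a real number with $c+\gamma>0$. If $f\in K_n^\sigma(\beta,\gamma)$, then the function $$F_c(z)=\frac{c+1}{z^c}\int_0^z t^{c-1}f(t)\,dt$$ also belongs to $K_n^\sigma(\beta,\gamma)$.
   Context: Let $E=\{z\in\mathbb{C}:|z|<1\}$ and let $A$ be the class of functions $f(z)=z+\sum_{k=2}^\infty a_kz^k$ analytic in $E$. For $f\in A$ and $c>-1$, the Bernardi integral $F_c$ is the element of $A$ with $F_c(z)=z+\sum_{k\ge2}\frac{c+1}{c+k}a_kz^k$. For an integer $n\ge 0$ and real $\sigma$, define for $f\in A$ $$L_n^\sigma f(z)=z+\sum_{k=2}^\infty k^n\left(\frac{2}{k+1}\right)^{\sigma}a_kz^k .$$ Equivalently $L_n^\sigma f=D^n(I^\sigma f)=I^\sigma(D^nf)$, where $D^0f=f$, $D^nf(z)=z\,[D^{n-1}f(z)]'$ is the Salagean derivative, and $I^\sigma f(z)=z+\sum_{k\ge 2}\left(\frac{2}{k+1}\right)^\sigma a_kz^k$ is the Jung-Kim-Srivastava operator (for $\sigma>0$ it equals $\frac{2^\sigma}{z\Gamma(\sigma)}\int_0^z\left(\log\frac zt\right)^{\sigma-1}f(t)\,dt$). For a nonnegative real number $\delta\neq 1$, the notation ''$X\sim\delta$'' means $X>\delta$ if $0\le\delta<1$, and $X<\delta$ if $\delta>1$. The class $B_n^\sigma(\gamma)$ (for real $\gamma\ge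 0$, $\gamma\ne 1$) consists of all $f\in A$ such that $\operatorname{Re}\dfrac{L_{n+1}^\sigma f(z)}{L_n^\sigma f(z)}\sim\gamma$ for all $z\in E$. The class $K_n^\sigma(\beta,\gamma)$ (for real $\beta\ge 0$, $\beta\neq 1$, and $0\le\gamma<1$) consists of all $f\in A$ for which there exists $g\in B_n^\sigma(\gamma)$ with $\operatorname{Re}\dfrac{L_{n+1}^\sigma f(z)}{L_n^\sigma g(z)}\sim\beta$ for all $z\in E$. In these conditions the quotients are understood as meromorphic functions on $E$ with removable singularities removed (so their value at $z=0$ is $1$), and the inequality is required at every point of $E$; in particular the quotient must have no poles in $E$. *)

(* Defs.v *)
(* Stdlib real numbers with Coquelicot. *)
From Stdlib Require Import Reals.
From Coquelicot Require Export Coquelicot.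
Open Scope R_scope.

Definition in_E (z : C) : Prop := Cmod z < 1.

Definition expands (a : nat -> C) (f : C -> C) : Prop :=
  forall z : C, in_E z -> is_pseries (K := C_AbsRing) (V := C_NormedModule) a z (f z).

(* Functions are total on [C]; only their values on [E] matter.  A function is
   analytic in the disk [E] when its expansion at 0 converges to it on all of [E]. *)
Definition class_A (f : C -> C) : Prop :=
  exists a : nat -> C, a 0%nat = RtoC 0 /\ a 1%nat = RtoC 1 /\ expands a f.

(* The expansion is unique, so this is the [k]-th Taylor coefficient of [f];
   [iota] is Coquelicot's definite description. *)
Definition coef (f : C -> C) (k : nat) : C :=
  iota (T := C_CompleteNormedModule)
    (fun l : C => exists a : nat -> C, expands a f /\ l = a k).

(* One formula covers all indices: for [f] in the class A the term [k = 0]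
   vanishes because [coef f 0 = 0], and the term [k = 1] is [z] because
   [1 ^ n * Rpower (2 / (1 + 1)) sigma = 1]. *)
Definition L (n : nat) (sigma : R) (f : C -> C) (z : C) : C :=
  iota (T := C_CompleteNormedModule)
    (is_pseries (K := C_AbsRing) (V := C_NormedModule)
       (fun k : nat =>
          (RtoC (INR k ^ n * Rpower (2 / (INR k + 1)) sigma) * coef f k)%C) z).

(* The relation [X ~ delta], for [0 <= delta] and [delta <> 1]. *)
Definition sim (X delta : R) : Prop :=
  (0 <= delta < 1 /\ X > delta) \/ (delta > 1 /\ X < delta).

(* [h] is the quotient [p / q] with its removable singularities removed; such an
   [h] exists on [E] only if the meromorphic function [p / q] has no pole there,
   and is unique on [E] because [q] is never identically zero in the uses below. *)
Definition is_quotient (p q h : C -> C) : Prop :=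
  (forall z : C, in_E z -> ex_derive (K := C_AbsRing) (V := C_NormedModule) h z) /\
  (forall z : C, in_E z -> q z <> RtoC 0 -> h z = (p z / q z)%C).

Definition Re_quotient_sim (p q : C -> C) (delta : R) : Prop :=
  exists h : C -> C,
    is_quotient p q h /\ forall z : C, in_E z -> sim (Re (h z)) delta.

Definition class_B (n : nat) (sigma gamma : R) (f : C -> C) : Prop :=
  class_A f /\ Re_quotient_sim (L (S n) sigma f) (L n sigma f) gamma.

Definition class_K (n : nat) (sigma beta gamma : R) (f : C -> C) : Prop :=
  class_A f /\
  exists g : C -> C,
    class_B n sigma gamma g /\
    Re_quotient_sim (L (S n) sigma f) (L n sigma g) beta.

(* Principal argument, in (-PI, PI], for [z <> 0]. *)
Definition Carg (z : C) : R :=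
  if Rlt_dec (Im z) 0 then - acos (Re z / Cmod z) else acos (Re z / Cmod z).

(* Principal branch of the power with real exponent, for [z <> 0]. *)
Definition Crpow (z : C) (c : R) : C :=
  (RtoC (Rpower (Cmod z) c) * (cos (c * Carg z), sin (c * Carg z)))%C.

(* Integral from 0 to [z] along the segment [t = s z], improper at 0. *)
Definition seg_integral (phi : C -> C) (z : C) : C :=
  (z * RInt_gen (V := C_R_CompleteNormedModule)
         (fun s : R => phi (RtoC s * z)%C) (at_right 0) (at_point 1))%C.

(* [Carg] is constant along the open segment, so the value does not depend on
   the branch used for both powers; the value at [z = 0] is 0. *)
Definition bernardi (c : R) (f : C -> C) (z : C) : C :=
  (RtoC (c + 1) / Crpow z c
     * seg_integral (fun t : C => Crpow t (c - 1) * f t) z)%C.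

(* Main.v *)
(** Let g be the companion of f in the definition of K. Write L_n g = zP,
    L_n F_c(g) = zQ, L_(n+1) F_c(f) = zU and L_(n+1) f = zV. Comparing
    coefficients, (c+1)Q + zQ' = (c+1)P and (c+1)U + zU' = (c+1)V.
    As Re (1 + zP'/P) > gamma >= 0, the modulus of zP increases along rays, so P has
    no zero in the disk, and r = Q/P is analytic without knowing that Q has no zeros.
    It satisfies zr' + (c + 1 + zP'/P) r = c + 1; looking at the first point where r
    leaves the disk of diameter (0, (c+1)/(c+gamma)), as in Jack's lemma, one
    sees that r never leaves it. Hence Q does not vanish and Re (P/Q) > (c+gamma)/(c+1),
    which is the claim on F_c(g), since L_(n+1) F_c(g) / L_n F_c(g) = (c+1) P/Q - c.
    Finally H = U/Q satisfies H + zH' r/(c+1) = V/P, and a first point where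
    Re H reaches beta is impossible because Re r >= 0. *)

Require Import Defs.
From Stdlib Require Import Reals Lra Classical ClassicalEpsilon.
From Coquelicot Require Import Coquelicot.
Open Scope R_scope.

(** * Complex derivatives *)

(** Division by z turns the quotients of both classes into quotients of power series with value 1 at
    the origin, so no singularity is left there. Put k = (c + gamma)/(c + 1). The disk of diameter
    (0, 1/k) is the image of the half-plane Re > k under inversion. Membership of r in this disk can
    be stated before anything is known about the zeros of Q, and since 0 is not in the open disk it
    excludes such zeros. The bound gamma < 1 is what puts r(0) = 1 inside. A contact point z is
    compared with every w in the closed disk |w| <= |z|, so a linear expansion at z alone gives the
    sign of the radial derivative and the vanishing of the tangential one. A real factor s lets one
    argument cover both beta < 1 and beta > 1. *)

Notation is_Cderive f z d :=
  (is_derive (K := C_AbsRing) (V := C_NormedModule) f z d) (only parsing).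

Notation is_Cpath_derive f t d :=
  (is_derive (K := R_AbsRing) (V := C_R_NormedModule) f t d) (only parsing).

Lemma is_Cderive_eps (f : C -> C) (z d : C) :
  is_Cderive f z d <->
  forall eps : R, 0 < eps -> exists delta : R, 0 < delta /\
    forall w : C, Cmod (w - z) < delta ->
      Cmod (f w - f z - (w - z) * d) <= eps * Cmod (w - z).
Proof.
split.
- intros [_ H] eps Heps.
  destruct (H z (fun P HP => HP) (mkposreal eps Heps)) as [delta Hd].
  exists delta; split; [apply cond_pos|].
  intros w Hw.
  exact (Hd w Hw).
- intros H; split; [apply (is_linear_scal_l (V := C_NormedModule))|].
  intros x Hx eps.
  apply (is_filter_lim_locally_unique (V := AbsRing_NormedModule C_AbsRing)) in Hx.
  subst x.
  destruct (H eps (cond_pos eps)) as [delta [Hd Hw]].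
  exists (mkposreal delta Hd); intros w Hw'.
  exact (Hw w Hw').
Qed.

Lemma is_Cpath_derive_eps (f : R -> C) (t : R) (d : C) :
  is_Cpath_derive f t d <->
  forall eps : R, 0 < eps -> exists delta : R, 0 < delta /\
    forall s : R, Rabs (s - t) < delta ->
      Cmod (f s - f t - RtoC (s - t) * d) <= eps * Rabs (s - t).
Proof.
assert (E : forall s, norm (V := C_R_NormedModule)
    (minus (minus (f s) (f t)) (scal (minus s t) d))
    = Cmod (f s - f t - RtoC (s - t) * d)).
{ intros s. rewrite Cmod_norm. f_equal.
  apply injective_projections; cbn; unfold minus, plus, opp, scal, mult; cbn;
  unfold mult; cbn; ring. }
split.
- intros [_ H] eps Heps.
  destruct (H t (fun P HP => HP) (mkposreal eps Heps)) as [delta Hd].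
  exists delta; split; [apply cond_pos|].
  intros s Hs. rewrite <- E. exact (Hd s Hs).
- intros H; split; [apply (is_linear_scal_l (V := C_R_NormedModule))|].
  intros x Hx eps.
  apply (is_filter_lim_locally_unique (V := R_NormedModule)) in Hx.
  subst x.
  destruct (H eps (cond_pos eps)) as [delta [Hd Hw]].
  exists (mkposreal delta Hd); intros s Hs.
  eapply Rle_trans; [right; apply E | exact (Hw s Hs)].
Qed.

Lemma is_Cderive_ray (f : C -> C) (z d : C) (t : R) :
  is_Cderive f (RtoC t * z)%C d ->
  is_Cpath_derive (fun s => f (RtoC s * z)%C) t (z * d)%C.
Proof.
rewrite is_Cderive_eps, is_Cpath_derive_eps; intros H eps Heps.
assert (Hz := Cmod_ge_0 z).
(* The [+ 1] keeps the denominator positive when z = 0. *)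
destruct (H (eps / (Cmod z + 1))) as [delta [Hd Hw]].
{ apply Rdiv_lt_0_compat; lra. }
exists (delta / (Cmod z + 1)); split.
{ apply Rdiv_lt_0_compat; lra. }
intros s Hs.
assert (Ez : (RtoC s * z - RtoC t * z = RtoC (s - t) * z)%C)
  by (rewrite RtoC_minus; ring).
specialize (Hw (RtoC s * z)%C). rewrite Ez, Cmod_mult, Cmod_R in Hw.
assert (Hs0 := Rabs_pos (s - t)).
assert (Hs1 : Rabs (s - t) * (Cmod z + 1) < delta).
{ apply Rlt_div_r in Hs; lra. }
replace (RtoC (s - t) * (z * d))%C with (RtoC (s - t) * z * d)%C by ring.
apply Rle_trans with (1 := Hw ltac:(nra)).
replace (eps * Rabs (s - t)) with
  (eps / (Cmod z + 1) * (Rabs (s - t) * (Cmod z + 1))) by (field; lra).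
apply Rmult_le_compat_l; [|nra].
apply Rlt_le, Rdiv_lt_0_compat; lra.
Qed.

Lemma is_Cpath_derive_Re (f : R -> C) (t : R) (d : C) :
  is_Cpath_derive f t d -> is_derive (fun s => Re (f s)) t (Re d).
Proof.
intros H.
apply (filterdiff_ext_lin _ (fun y : R_NormedModule =>
   fst (scal (y : R_AbsRing) (d : C_R_NormedModule) : C_R_NormedModule))).
{ apply (filterdiff_comp' f (fun c : C_R_NormedModule => fst c) t _ fst H).
  apply filterdiff_linear, is_linear_fst. }
intros y; reflexivity.
Qed.

Lemma is_Cpath_derive_Im (f : R -> C) (t : R) (d : C) :
  is_Cpath_derive f t d -> is_derive (fun s => Im (f s)) t (Im d).
Proof.
intros H.
apply (filterdiff_ext_lin _ (fun y : R_NormedModule =>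
   snd (scal (y : R_AbsRing) (d : C_R_NormedModule) : C_R_NormedModule))).
{ apply (filterdiff_comp' f (fun c : C_R_NormedModule => snd c) t _ snd H).
  apply filterdiff_linear, is_linear_snd. }
intros y; reflexivity.
Qed.

Lemma Cmod_sub_sym (z w : C) : Cmod (z - w) = Cmod (w - z).
Proof. rewrite <- Cmod_opp. f_equal. ring. Qed.

Lemma Cmod_sub_triangle (z w : C) : Cmod z - Cmod w <= Cmod (z - w).
Proof.
assert (H := Cmod_triangle (z - w) w).
replace (z - w + w)%C with z in H by ring. lra.
Qed.

Lemma is_Cderive_lipschitz (f : C -> C) (z d : C) :
  is_Cderive f z d ->
  exists delta : R, 0 < delta /\ forall w : C, Cmod (w - z) < delta ->
    Cmod (f w - f z) <= (Cmod d + 1) * Cmod (w - z).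
Proof.
rewrite is_Cderive_eps; intros H.
destruct (H 1 Rlt_0_1) as [delta [Hd Hw]].
exists delta; split; [exact Hd|]; intros w Hw'.
specialize (Hw w Hw').
assert (T := Cmod_triangle (f w - f z - (w - z) * d) ((w - z) * d)).
replace (f w - f z - (w - z) * d + (w - z) * d)%C with (f w - f z)%C in T by ring.
rewrite Cmod_mult in T. lra.
Qed.

Lemma is_Cderive_continuous (f : C -> C) (z d : C) :
  is_Cderive f z d ->
  forall eps : R, 0 < eps -> exists delta : R, 0 < delta /\
    forall w : C, Cmod (w - z) < delta -> Cmod (f w - f z) < eps.
Proof.
intros H eps Heps.
destruct (is_Cderive_lipschitz _ _ _ H) as [delta [Hd Hw]].
assert (D := Cmod_ge_0 d).
exists (Rmin delta (eps / (Cmod d + 1))); split.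
{ apply Rmin_pos; [exact Hd|]. apply Rdiv_lt_0_compat; lra. }
intros w Hw'.
apply Rle_lt_trans with (1 := Hw w (Rlt_le_trans _ _ _ Hw' (Rmin_l _ _))).
assert (H1 := Rlt_le_trans _ _ _ Hw' (Rmin_r _ _)).
apply Rlt_div_r in H1; lra.
Qed.

Lemma is_Cderive_mult (f g : C -> C) (z df dg : C) :
  is_Cderive f z df -> is_Cderive g z dg ->
  is_Cderive (fun w => (f w * g w)%C) z (df * g z + f z * dg)%C.
Proof.
intros [_ Hf] [_ Hg].
(* [C_NormedModule] and [AbsRing_NormedModule C_AbsRing] have the same norm but
   different balls, so the two derivatives are not convertible. *)
destruct (is_derive_mult (K := C_AbsRing) f g z df dg) as [_ H].
- split; [apply is_linear_scal_l | exact Hf].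
- split; [apply is_linear_scal_l | exact Hg].
- exact Cmult_comm.
- split; [apply (is_linear_scal_l (V := C_NormedModule)) | exact H].
Qed.

Lemma is_Cderive_inv (f : C -> C) (z d : C) :
  is_Cderive f z d -> f z <> 0%C ->
  is_Cderive (fun w => / f w)%C z (- d / (f z * f z))%C.
Proof.
intros Hf Hz.
assert (Hm : 0 < Cmod (f z)) by now apply Cmod_gt_0.
assert (D := Cmod_ge_0 d).
set (m := Cmod (f z)) in *.
destruct (is_Cderive_lipschitz _ _ _ Hf) as [d1 [Hd1 L1]].
destruct (is_Cderive_continuous _ _ _ Hf (m / 2)) as [d2 [Hd2 L2]]; [lra|].
rewrite is_Cderive_eps in Hf.
apply is_Cderive_eps; intros eps Heps.
(* Once |f w| > m/2, this constant and [B] below make each of the two terms of the decomposition at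
   most eps/2 times |w - z|. *)
destruct (Hf (eps * (m * m) / 4)) as [d3 [Hd3 L3]].
{ assert (0 < m * m) by nra. assert (0 < eps * (m * m)) by nra. lra. }
pose (B := 4 * (Cmod d + 1) * (Cmod d + 1) / (m * m * m)).
assert (HB : 0 < B).
{ apply Rdiv_lt_0_compat; [nra|]. repeat apply Rmult_lt_0_compat; lra. }
exists (Rmin (Rmin d1 d2) (Rmin d3 (eps / B))); split.
{ repeat apply Rmin_pos; try lra. apply Rdiv_lt_0_compat; lra. }
intros w Hw.
assert (M1 := Rmin_l (Rmin d1 d2) (Rmin d3 (eps / B))).
assert (M2 := Rmin_r (Rmin d1 d2) (Rmin d3 (eps / B))).
assert (M3 := Rmin_l d1 d2). assert (M4 := Rmin_r d1 d2).
assert (M5 := Rmin_l d3 (eps / B)). assert (M6 := Rmin_r d3 (eps / B)).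
specialize (L1 w ltac:(lra)). specialize (L2 w ltac:(lra)).
specialize (L3 w ltac:(lra)).
assert (HwB : Cmod (w - z) * B < eps) by (apply Rlt_div_r; lra).
assert (W0 := Cmod_ge_0 (w - z)).
assert (Hm2 : m / 2 < Cmod (f w)).
{ assert (T := Cmod_sub_triangle (f z) (f w)).
  rewrite Cmod_sub_sym in T. fold m in T. lra. }
assert (Hfw : f w <> 0%C).
{ apply Cmod_gt_0. lra. }
(* 1/b - 1/a + hd/a^2 = -(b - a - hd)/(ab) + hd(b - a)/(a^2 b) with a = f z, b = f w *)
replace (/ f w - / f z - (w - z) * (- d / (f z * f z)))%C with
  (- ((f w - f z - (w - z) * d) / (f z * f w))
   + (w - z) * d * (f w - f z) / (f z * f z * f w))%C by (field; auto).
eapply Rle_trans; [apply Cmod_triangle|].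
rewrite Cmod_opp.
rewrite !Cmod_div by (repeat apply Cmult_neq_0; auto).
rewrite !Cmod_mult. fold m.
set (x := Cmod (w - z)) in *.
assert (A1 : Cmod (f w - f z - (w - z) * d) / (m * Cmod (f w)) <= eps / 2 * x).
{ apply Rle_div_l; [nra|].
  apply Rle_trans with (1 := L3).
  replace (eps * (m * m) / 4 * x) with (eps / 2 * x * (m * (m / 2))) by field.
  apply Rmult_le_compat_l; nra. }
assert (A2 : x * Cmod d * Cmod (f w - f z) / (m * m * Cmod (f w)) <= eps / 2 * x).
{ apply Rle_div_l; [repeat apply Rmult_lt_0_compat; lra|].
  apply Rle_trans with (x * ((Cmod d + 1) * ((Cmod d + 1) * x))).
  - rewrite Rmult_assoc. apply Rmult_le_compat_l; [lra|].
    apply Rmult_le_compat; try lra. apply Cmod_ge_0.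
  - apply Rle_trans with (eps / 2 * x * (m * m * (m / 2))).
    2:{ apply Rmult_le_compat_l; [nra|]. apply Rmult_le_compat_l; nra. }
    apply Rle_trans with (x * (x * B) * (m * m * m) / 4).
    + right. unfold B. field. lra.
    + replace (eps / 2 * x * (m * m * (m / 2))) with (x * eps * (m * m * m) / 4) by field.
      apply Rmult_le_compat_r; [lra|].
      apply Rmult_le_compat_r; [apply Rlt_le; repeat apply Rmult_lt_0_compat; lra|].
      apply Rmult_le_compat_l; lra. }
lra.
Qed.

(** The quotient f/g is kept inside its own derivative, so that first-order equations for f and g
    turn directly into one for f/g. *)
Lemma is_Cderive_div (f g : C -> C) (z df dg : C) :
  is_Cderive f z df -> is_Cderive g z dg -> g z <> 0%C ->
  is_Cderive (fun w => f w / g w)%C z ((df - f z / g z * dg) / g z)%C.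
Proof.
intros Hf Hg H0.
replace ((df - f z / g z * dg) / g z)%C with
  (df * / g z + f z * (- dg / (g z * g z)))%C by (field; exact H0).
apply (is_Cderive_mult f (fun w => / g w)%C); [exact Hf|].
now apply is_Cderive_inv.
Qed.

(** * First contact arguments *)

Lemma Re_minus (z w : C) : Re (z - w)%C = Re z - Re w.
Proof. reflexivity. Qed.

(** Takes the place of Jack's lemma. An affine function of s that is nonpositive for all real s is
    constant, which kills the tangential part Im (zD); s = 0 then gives the sign of the radial
    part. *)
Lemma radial_derivative_at_max (Psi : C -> C) (z D : C) :
  is_Cderive Psi z D ->
  (forall w : C, Cmod w <= Cmod z -> Re (Psi w) <= Re (Psi z)) ->
  Im (z * D)%C = 0 /\ 0 <= Re (z * D)%C.
Proof.
intros HD Hmax.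
(* moving from z in an inward direction z(-1 + is) cannot increase Re Psi *)
assert (K : forall s : R, - Re (z * D)%C - s * Im (z * D)%C <= 0).
{ intros s. apply Rnot_lt_le; intros HX.
  set (X := - Re (z * D)%C - s * Im (z * D)%C) in HX.
  pose (v := (-1, s) : C).
  assert (EX : Re (z * v * D)%C = X).
  { unfold X, v, Re, Im; destruct z as [z1 z2], D as [D1 D2]; cbn; ring. }
  assert (N := Cmod_ge_0 (z * v)).
  rewrite is_Cderive_eps in HD.
  (* With this tolerance the linearization error is at most half of the gain e X, so a positive X
     would increase Re Psi. *)
  destruct (HD (X / (2 * (Cmod (z * v) + 1)))) as [delta [Hd Hw]].
  { apply Rdiv_lt_0_compat; lra. }
  (* The first bound gives |1 + e v|^2 = 1 - 2e + e^2 (1 + s^2) <= 1, so w stays in the closed disk;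
     the second keeps w within delta of z. *)
  pose (e := Rmin (1 / (1 + s * s)) (delta / (2 * (Cmod (z * v) + 1)))).
  assert (He : 0 < e).
  { apply Rmin_pos; apply Rdiv_lt_0_compat; nra. }
  assert (He1 : e * (1 + s * s) <= 1).
  { apply Rle_div_r; [nra|]. apply Rmin_l. }
  assert (He2 : e * (2 * (Cmod (z * v) + 1)) <= delta).
  { apply Rle_div_r; [lra|]. apply Rmin_r. }
  pose (w := (z * (1 + RtoC e * v))%C).
  assert (Ew : (w - z)%C = (RtoC e * (z * v))%C) by (unfold w; ring).
  assert (Cw : Cmod (w - z) = e * Cmod (z * v)).
  { rewrite Ew, Cmod_mult, Cmod_R, Rabs_pos_eq; lra. }
  assert (Hin : Cmod w <= Cmod z).
  { unfold w. rewrite Cmod_mult. rewrite <- (Rmult_1_r (Cmod z)) at 2.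
    apply Rmult_le_compat_l; [apply Cmod_ge_0|].
    apply Rle_trans with (sqrt 1); [apply sqrt_le_1_alt | rewrite sqrt_1; lra].
    unfold v; cbn. nra. }
  specialize (Hmax w Hin).
  specialize (Hw w ltac:(rewrite Cw; nra)).
  assert (R1 := re_le_Cmod (Psi w - Psi z - (w - z) * D)).
  assert (ER : Re (Psi w - Psi z - (w - z) * D)%C = Re (Psi w) - Re (Psi z) - e * X).
  { rewrite Ew, <- EX. rewrite !Re_minus. f_equal.
    unfold Re; cbn; ring. }
  rewrite ER in R1. rewrite Cw in Hw.
  assert (R2 := Rle_abs (- (Re (Psi w) - Re (Psi z) - e * X))).
  rewrite Rabs_Ropp in R2.
  assert (R3 : X / (2 * (Cmod (z * v) + 1)) * (e * Cmod (z * v)) <= e * X / 2).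
  { replace (e * X / 2) with
      (X / (2 * (Cmod (z * v) + 1)) * (e * (Cmod (z * v) + 1))) by (field; lra).
    apply Rmult_le_compat_l; [apply Rlt_le, Rdiv_lt_0_compat; lra|nra]. }
  nra. }
set (a := Re (z * D)%C) in *. set (b := Im (z * D)%C) in *.
assert (Hb : b = 0).
{ destruct (Req_dec b 0) as [|Hb]; [assumption|exfalso].
  assert (K1 := K (- (a + 1) / b)).
  replace (- a - - (a + 1) / b * b) with 1 in K1 by (field; assumption). lra. }
split; [exact Hb|]. specialize (K 0). lra.
Qed.

(** Compactness of the square [-1,1]^2 for a gauge: half a radius of negativity at points of the
    closed disk, a quarter of the distance to the disk at points outside. Outer gauges are too small
    to reach points just beyond the disk, so such points are controlled by centres inside it. *)
Lemma negative_on_larger_disk (Phi : C -> R) (m : R) :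
  (forall z : C, in_E z -> Phi z < 0 -> exists delta : R, 0 < delta /\
     forall w : C, Cmod (w - z) < delta -> Phi w < 0) ->
  0 <= m < 1 -> (forall z : C, Cmod z <= m -> Phi z < 0) ->
  exists m' : R, m < m' /\ forall z : C, Cmod z < m' -> Phi z < 0.
Proof.
intros Hopen Hm Hneg.
assert (Hdelta : forall u v : R, exists delta : posreal,
  (Cmod (u, v) <= m -> forall w : C, Cmod (w - (u, v)) < 2 * delta -> Phi w < 0) /\
  (m < Cmod (u, v) -> 4 * delta <= Cmod (u, v) - m)).
{ intros u v. destruct (Rle_lt_dec (Cmod (u, v)) m) as [H|H].
  - destruct (Hopen (u, v)) as [delta [Hd Hw]].
    + unfold in_E; lra.
    + now apply Hneg.
    + assert (Hd2 : 0 < delta / 2) by lra.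
      exists (mkposreal _ Hd2); cbn; split; [|lra].
      intros _ w Hw'; apply Hw; lra.
  - assert (Hd2 : 0 < (Cmod (u, v) - m) / 4) by lra.
    exists (mkposreal _ Hd2); cbn; split; lra. }
pose (delta := fun u v => proj1_sig (constructive_indefinite_description _ (Hdelta u v))).
assert (Pdelta : forall u v : R,
  (Cmod (u, v) <= m -> forall w : C, Cmod (w - (u, v)) < 2 * delta u v -> Phi w < 0) /\
  (m < Cmod (u, v) -> 4 * delta u v <= Cmod (u, v) - m)).
{ intros u v. unfold delta. now destruct constructive_indefinite_description. }
destruct (compactness_value_2d (-1) 1 (-1) 1 delta) as [d Hd].
(* The cap 1 keeps the points inside the square on which compactness was applied. *)
exists (Rmin 1 (m + d)); split.
{ apply Rmin_glb_lt; [lra|]. assert (H := cond_pos d). lra. }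
intros [x y] Hz.
assert (Hz1 := Rlt_le_trans _ _ _ Hz (Rmin_l _ _)).
assert (Hz2 := Rlt_le_trans _ _ _ Hz (Rmin_r _ _)).
apply Rnot_le_lt; intros Hpos.
assert (Hbox := Rmax_Cmod (x, y)); cbn in Hbox.
assert (B1 := Rmax_l (Rabs x) (Rabs y)).
assert (B2 := Rmax_r (Rabs x) (Rabs y)).
apply (Hd x y); [apply Rabs_le_between; lra..|].
intros [u [v [_ [_ [H1 [H2 H3]]]]]].
assert (Hdist : Cmod ((x, y) - (u, v)) < 2 * delta u v).
{ apply Rle_lt_trans with (1 := Cmod_2Rmax _).
  assert (Hmx : Rmax (Rabs (x - u)) (Rabs (y - v)) < delta u v) by now apply Rmax_lub_lt.
  apply Rle_lt_trans with (2 * Rmax (Rabs (x - u)) (Rabs (y - v))).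
  - apply Rmult_le_compat_r; [apply Rle_trans with (2 := Rmax_l _ _); apply Rabs_pos|].
    apply Rle_trans with (sqrt (2 * 2)); [apply sqrt_le_1_alt | rewrite sqrt_square]; lra.
  - lra. }
destruct (Pdelta u v) as [P1 P2].
destruct (Rle_lt_dec (Cmod (u, v)) m) as [H|H].
- specialize (P1 H _ Hdist). lra.
- specialize (P2 H). assert (T := Cmod_sub_triangle (u, v) (x, y)).
  rewrite Cmod_sub_sym in T. assert (Dp := cond_pos d). lra.
Qed.

(** Let m be the supremum of the radii of open disks where Phi < 0. If Phi were negative on the
    whole circle of radius m, a larger disk would do; hence Phi >= 0 somewhere on it, while
    continuity gives Phi <= 0 on the closed disk. *)
Lemma negative_on_disk_by_first_contact (Phi : C -> R) :
  (forall z : C, in_E z -> forall eps : R, 0 < eps -> exists delta : R, 0 < delta /\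
     forall w : C, Cmod (w - z) < delta -> Rabs (Phi w - Phi z) < eps) ->
  Phi 0%C < 0 ->
  (forall z : C, in_E z -> z <> 0%C -> Phi z = 0 ->
     ~ (forall w : C, Cmod w <= Cmod z -> Phi w <= 0)) ->
  forall z : C, in_E z -> Phi z < 0.
Proof.
intros Hcont H0 Hcontact z1 Hz1.
apply Rnot_le_lt; intros Hpos.
assert (Hopen : forall z : C, in_E z -> Phi z < 0 -> exists delta : R, 0 < delta /\
     forall w : C, Cmod (w - z) < delta -> Phi w < 0).
{ intros z Hz Hneg. destruct (Hcont z Hz (- Phi z)) as [delta [Hd Hw]]; [lra|].
  exists delta; split; [exact Hd|]. intros w Hw'. specialize (Hw w Hw').
  apply Rabs_lt_between in Hw. lra. }
(* Capping the radii at |z1|, for a supposed bad point z1, bounds the set and keeps the contact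
   radius below 1. *)
pose (T := fun r => 0 <= r <= Cmod z1 /\ forall z, Cmod z < r -> Phi z < 0).
assert (N1 := Cmod_ge_0 z1).
destruct (completeness T) as [m [Hub Hlub]].
{ exists (Cmod z1); intros r [Hr _]; apply Hr. }
{ exists 0; split; [lra|]. intros z Hz. assert (H := Cmod_ge_0 z). lra. }
unfold is_upper_bound in Hub.
assert (Hm1 : m <= Cmod z1) by (apply Hlub; intros r [Hr _]; apply Hr).
assert (Hm0 : 0 <= m).
{ apply Hub. split; [lra|]. intros z Hz. assert (H := Cmod_ge_0 z). lra. }
assert (Hin : forall z, Cmod z < m -> Phi z < 0).
{ intros z Hz. apply NNPP; intros Hn.
  assert (m <= Cmod z); [|lra].
  apply Hlub. intros r [_ Hr]. apply Rnot_lt_le; intros Hrz. now apply Hn, Hr. }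
unfold in_E in Hz1.
assert (Hex : exists z, Cmod z = m /\ 0 <= Phi z).
{ apply NNPP; intros Hn.
  destruct (negative_on_larger_disk Phi m Hopen) as [m' [Hm' Hneg]]; [lra| |].
  { intros z [Hz|Hz]; [now apply Hin|].
    apply Rnot_le_lt; intros Hp. apply Hn. now exists z. }
  destruct (Rlt_le_dec (Cmod z1) m') as [H|H].
  - specialize (Hneg _ H). lra.
  - assert (m' <= m); [|lra]. apply Hub. split; [lra|exact Hneg]. }
destruct Hex as [z [Ez Hz]].
assert (HzE : in_E z) by (unfold in_E; lra).
assert (Hz0 : z <> 0%C) by (intros ->; lra).
assert (Hle : forall w, Cmod w <= Cmod z -> Phi w <= 0).
{ intros w Hw. apply Rnot_lt_le; intros Hp.
  destruct (Hcont w) with (eps := Phi w) as [delta [Hd Hdw]]; [unfold in_E; lra|exact Hp|].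
  assert (Wp := Cmod_ge_0 w).
  (* shrink w towards 0 into the open disk, where Phi < 0 *)
  pose (e := Rmin 1 (delta / 2)).
  assert (e1 : e <= 1) by apply Rmin_l.
  assert (e2 : e <= delta / 2) by apply Rmin_r.
  assert (e0 : 0 < e) by (apply Rmin_pos; lra).
  assert (Hw1 : Phi (RtoC (1 - e) * w)%C < 0).
  { destruct (Req_dec (Cmod w) 0) as [Hw0|Hw0].
    - apply Cmod_eq_0 in Hw0. subst w. now rewrite Cmult_0_r.
    - apply Hin. rewrite Cmod_mult, Cmod_R, Rabs_pos_eq by lra. nra. }
  specialize (Hdw (RtoC (1 - e) * w)%C).
  replace (RtoC (1 - e) * w - w)%C with (RtoC (- e) * w)%C in Hdw
    by (rewrite RtoC_opp, RtoC_minus; ring).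
  rewrite Cmod_mult, Cmod_R, Rabs_Ropp, Rabs_pos_eq in Hdw by lra.
  specialize (Hdw ltac:(nra)). apply Rabs_lt_between in Hdw. lra. }
apply (Hcontact z HzE Hz0); [|exact Hle].
apply Rle_antisym; [apply Hle; lra|exact Hz].
Qed.

(** * Two differential inequalities *)

Lemma is_derive_nondecreasing (m dm : R -> R) (a b : R) :
  a <= b ->
  (forall t : R, a <= t <= b -> is_derive m t (dm t)) ->
  (forall t : R, a <= t <= b -> 0 <= dm t) ->
  m a <= m b.
Proof.
intros Hab Hd Hp.
destruct (MVT_gen m a b dm) as [t [Ht E]].
- intros t Ht. rewrite Rmin_left, Rmax_right in Ht by lra. apply Hd; lra.
- intros t Ht. rewrite Rmin_left, Rmax_right in Ht by lra.
  apply continuity_pt_filterlim.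
  apply (ex_derive_continuous m). exists (dm t). apply Hd; lra.
- rewrite Rmin_left, Rmax_right in Ht by lra. specialize (Hp t Ht). nra.
Qed.

Lemma C_neq_0_sqr (z : C) : z <> 0%C <-> 0 < Re z * Re z + Im z * Im z.
Proof.
split.
- intros H. apply Rnot_le_lt; intros Hle. apply H.
  assert (Re z = 0) by nra. assert (Im z = 0) by nra.
  now apply injective_projections.
- intros H ->. cbn in H. lra.
Qed.

(* Along a ray, d/dt |tP(tz)|^2 = 2t |P|^2 Re h >= 0, also where P vanishes. *)
Lemma starlike_nonvanishing (P dP h : C -> C) :
  (forall z : C, in_E z -> is_Cderive P z (dP z)) ->
  P 0%C = 1%C ->
  (forall z : C, in_E z -> z <> 0%C -> P z <> 0%C ->
     (h z * P z = P z + z * dP z)%C) ->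
  (forall z : C, in_E z -> 0 <= Re (h z)) ->
  forall z : C, in_E z -> P z <> 0%C.
Proof.
intros HdP HP0 Hh Hre z Hz.
destruct (classic (z = 0%C)) as [->|Hz0].
{ rewrite HP0. intros E; injection E; lra. }
assert (Hray : forall t : R, 0 <= t <= 1 -> in_E (RtoC t * z)).
{ intros t Ht. unfold in_E in *. rewrite Cmod_mult, Cmod_R, Rabs_pos_eq by lra.
  assert (N := Cmod_ge_0 z). nra. }
pose (u := fun t => Re (P (RtoC t * z)%C)). pose (v := fun t => Im (P (RtoC t * z)%C)).
pose (du := fun t => Re (z * dP (RtoC t * z))%C).
pose (dv := fun t => Im (z * dP (RtoC t * z))%C).
assert (Hu : forall t, 0 <= t <= 1 -> is_derive u t (du t)).
{ intros t Ht. apply is_Cpath_derive_Re, is_Cderive_ray, HdP, Hray, Ht. }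
assert (Hv : forall t, 0 <= t <= 1 -> is_derive v t (dv t)).
{ intros t Ht. apply is_Cpath_derive_Im, is_Cderive_ray, HdP, Hray, Ht. }
destruct (is_Cderive_continuous P 0%C (dP 0%C)) with (eps := 1) as [delta [Hd Hnear]].
{ apply HdP. unfold in_E. rewrite Cmod_0. lra. }
{ lra. }
assert (Nz : 0 < Cmod z) by now apply Cmod_gt_0.
unfold in_E in Hz.
(* Monotonicity from t = 0 would say nothing, as t^2 |P|^2 vanishes there; the start is a small t0 >
   0 at which P is still close to P(0) = 1. *)
pose (t0 := Rmin 1 (delta / 2)).
assert (t01 : t0 <= 1) by apply Rmin_l.
assert (t02 : t0 <= delta / 2) by apply Rmin_r.
assert (t00 : 0 < t0) by (apply Rmin_pos; lra).
assert (Ht0 : P (RtoC t0 * z)%C <> 0%C).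
{ intros E. specialize (Hnear (RtoC t0 * z)%C).
  replace (RtoC t0 * z - 0)%C with (RtoC t0 * z)%C in Hnear by ring.
  rewrite E, HP0, Cmod_mult, Cmod_R, Rabs_pos_eq in Hnear by lra.
  replace (0 - 1)%C with (- (1))%C in Hnear by ring.
  rewrite Cmod_m1 in Hnear. specialize (Hnear ltac:(nra)). lra. }
apply C_neq_0_sqr in Ht0. fold (u t0) in Ht0. fold (v t0) in Ht0.
assert (Hm : (t0 * t0) * (u t0 * u t0 + v t0 * v t0) <= (1 * 1) * (u 1 * u 1 + v 1 * v 1)).
{ apply (is_derive_nondecreasing (fun t => (t * t) * (u t * u t + v t * v t))
    (fun t => 2 * t * (u t * (u t + t * du t) + v t * (v t + t * dv t)))); [exact t01|..].
  - intros t Ht.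
    assert (Hu' := Hu t ltac:(lra)). assert (Hv' := Hv t ltac:(lra)).
    assert (Eu : Derive u t = du t) by now apply is_derive_unique.
    assert (Ev : Derive v t = dv t) by now apply is_derive_unique.
    auto_derive.
    + repeat split; first [now exists (du t) | now exists (dv t)].
    + change (Derive (fun x : R => u x) t) with (Derive u t).
      change (Derive (fun x : R => v x) t) with (Derive v t).
      rewrite Eu, Ev. ring.
  - intros t Ht. apply Rmult_le_pos; [lra|].
    (* At a zero of P both u and v vanish, hence so does the derivative; elsewhere it is 2t |P|^2 Re
       h. *)
    destruct (classic (P (RtoC t * z)%C = 0%C)) as [E|Hne].
    + unfold u, v. rewrite E. cbn. lra.
    + assert (HE := Hray t ltac:(lra)).
      assert (Hw0 : (RtoC t * z)%C <> 0%C).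
      { apply Cmult_neq_0; [intros E; apply RtoC_inj in E; lra|exact Hz0]. }
      specialize (Hh _ HE Hw0 Hne). specialize (Hre _ HE).
      assert (E1 : u t + t * du t = Re (h (RtoC t * z) * P (RtoC t * z))%C).
      { rewrite Hh. unfold u, du, Re; cbn; ring. }
      assert (E2 : v t + t * dv t = Im (h (RtoC t * z) * P (RtoC t * z))%C).
      { rewrite Hh. unfold v, dv, Im; cbn; ring. }
      rewrite E1, E2. unfold u, v, Re, Im in *.
      destruct (h (RtoC t * z)%C) as [h1 h2], (P (RtoC t * z)%C) as [p1 p2]; cbn in *.
      replace (p1 * (h1 * p1 - h2 * p2) + p2 * (h1 * p2 + h2 * p1))
        with (h1 * (p1 * p1 + p2 * p2)) by ring.
      apply Rmult_le_pos; nra. }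
apply C_neq_0_sqr.
unfold u at 3 4, v at 3 4 in Hm. rewrite Cmult_1_l in Hm.
assert (0 < t0 * t0) by nra.
assert (0 < t0 * t0 * (u t0 * u t0 + v t0 * v t0)) by now apply Rmult_lt_0_compat.
lra.
Qed.

Lemma sqr_Cmod (z : C) : Cmod z * Cmod z = Re z * Re z + Im z * Im z.
Proof. assert (H := Cmod2_alt z). nra. Qed.

(** For r = z/w the disk condition expands to k |r|^2 < Re r, which makes Re r positive and says Re
    (1/r) > k. It fails at r = 0, whence z is nonzero. *)
Lemma Re_div_gt (z w : C) (k : R) :
  0 < k -> Cmod (z / w - RtoC (/ (2 * k))) < / (2 * k) -> w <> 0%C ->
  z <> 0%C /\ 0 <= Re (z / w)%C /\ k < Re (w / z)%C.
Proof.
intros Hk Hd Hw.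
set (rho := / (2 * k)) in *.
assert (Hrho : 0 < rho) by (apply Rinv_0_lt_compat; lra).
assert (Ek : 2 * rho * k = 1) by (unfold rho; field; lra).
assert (Hz : z <> 0%C).
{ intros ->. unfold Cdiv in Hd. rewrite Cmult_0_l in Hd.
  rewrite Cmod_sub_sym in Hd. replace (RtoC rho - 0)%C with (RtoC rho) in Hd by ring.
  rewrite Cmod_R, Rabs_pos_eq in Hd; lra. }
split; [exact Hz|].
assert (Er : (w / z)%C = (/ (z / w))%C) by (field; auto).
assert (Hr0 : (z / w)%C <> 0%C).
{ intros E. apply Hz. replace z with (z / w * w)%C by (field; exact Hw).
  rewrite E. ring. }
rewrite Er. set (r := (z / w)%C) in *.
assert (S := sqr_Cmod (r - RtoC rho)).
assert (N := Cmod_ge_0 (r - RtoC rho)).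
apply C_neq_0_sqr in Hr0.
unfold Re, Im in *; destruct r as [x y]; cbn in *.
assert (S' : x * x + y * y < 2 * rho * x) by nra.
assert (Hx : 0 < x) by nra.
split; [lra|].
apply Rlt_div_r; [nra|]. nra.
Qed.

(* With r = Q/P, the hypotheses read zr' + (c + h)r = c + 1. At a first contact
   of r with the circle |r - rho| = rho, the number zr'/(r - rho) is real and
   nonnegative, which forces Re (c + h) <= c + gamma. *)
Lemma bernardi_ratio_in_disk (c gamma : R) (P dP Q dQ h : C -> C) :
  c > -1 -> gamma < 1 -> c + gamma > 0 ->
  (forall z : C, in_E z -> is_Cderive P z (dP z)) ->
  (forall z : C, in_E z -> is_Cderive Q z (dQ z)) ->
  P 0%C = 1%C -> Q 0%C = 1%C ->
  (forall z : C, in_E z -> P z <> 0%C) ->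
  (forall z : C, in_E z ->
     (RtoC (c + 1) * Q z + z * dQ z = RtoC (c + 1) * P z)%C) ->
  (forall z : C, in_E z -> z <> 0%C -> (h z * P z = P z + z * dP z)%C) ->
  (forall z : C, in_E z -> gamma < Re (h z)) ->
  let rho := / (2 * ((c + gamma) / (c + 1))) in
  forall z : C, in_E z -> Cmod (Q z / P z - RtoC rho) < rho.
Proof.
intros Hc Hg Hcg HdP HdQ HP0 HQ0 HPn HQP Hh Hre rho.
assert (Erho : 2 * rho * (c + gamma) = c + 1) by (unfold rho; field; lra).
(* Comes from gamma < 1 and amounts to |1 - rho| < rho, the initial condition at the origin. *)
assert (Hrho : 1 / 2 < rho) by nra.
pose (r := fun z => (Q z / P z)%C).
pose (dr := fun z => ((dQ z - Q z / P z * dP z) / P z)%C).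
assert (Hdr : forall z, in_E z -> is_Cderive r z (dr z)).
{ intros z Hz. apply is_Cderive_div; auto. }
assert (Hode : forall z, in_E z -> z <> 0%C ->
  (z * dr z)%C = (RtoC (c + 1) - (RtoC c + h z) * r z)%C).
{ intros z Hz Hz0. unfold dr, r.
  assert (E1 := HQP z Hz). assert (E2 := Hh z Hz Hz0). assert (HP := HPn z Hz).
  replace (z * ((dQ z - Q z / P z * dP z) / P z))%C
    with ((z * dQ z) / P z - Q z / P z * (z * dP z) / P z)%C by (field; exact HP).
  replace (z * dQ z)%C with (RtoC (c + 1) * P z - RtoC (c + 1) * Q z)%C
    by (rewrite <- E1; ring).
  replace (z * dP z)%C with (h z * P z - P z)%C by (rewrite E2; ring).
  rewrite RtoC_plus. field. exact HP. }
intros z Hz. apply Rminus_lt. change (Q z / P z)%C with (r z). revert z Hz.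
apply (negative_on_disk_by_first_contact (fun z => Cmod (r z - RtoC rho) - rho)).
- intros z Hz eps Heps.
  destruct (is_Cderive_continuous r z (dr z) (Hdr z Hz) eps Heps) as [delta [Hd Hw]].
  exists delta; split; [exact Hd|]. intros w Hw'. specialize (Hw w Hw').
  assert (T1 := Cmod_sub_triangle (r w - RtoC rho) (r z - RtoC rho)).
  assert (T2 := Cmod_sub_triangle (r z - RtoC rho) (r w - RtoC rho)).
  rewrite (Cmod_sub_sym (r z - RtoC rho)) in T2.
  replace (r w - RtoC rho - (r z - RtoC rho))%C with (r w - r z)%C in T1, T2 by ring.
  apply Rabs_lt_between. lra.
- unfold r. rewrite HP0, HQ0.
  replace (1 / 1 - RtoC rho)%C with (RtoC (1 - rho))
    by (rewrite RtoC_minus; field; intros E; injection E; lra).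
  rewrite Cmod_R.
  apply Rlt_minus, Rabs_lt_between. lra.
- intros z Hz Hz0 Hcontact Hle.
  assert (Hmod : Cmod (r z - RtoC rho) = rho) by lra.
  (* Rotating by this conjugate turns the maximum of |r - rho| at z into a maximum of the real part
     of the differentiable function q r. *)
  pose (q := Cconj (r z - RtoC rho)).
  assert (Hq : Cmod q = rho) by (unfold q; now rewrite Cmod_conj).
  destruct (radial_derivative_at_max (fun w => (q * r w)%C) z (0 * r z + q * dr z)%C)
    as [HIm HRe].
  { apply (is_Cderive_mult (fun _ => q) r); [|now apply Hdr].
    apply (is_derive_const (V := C_NormedModule) q). }
  { intros w Hw.
    assert (R1 := re_le_Cmod (q * (r w - RtoC rho))).
    rewrite Cmod_mult, Hq in R1.
    assert (R2 := Rle_abs (Re (q * (r w - RtoC rho)))).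
    specialize (Hle w Hw).
    assert (R3 : Re (q * (r w - RtoC rho)) <= rho * rho) by nra.
    assert (S := sqr_Cmod (r z - RtoC rho)). rewrite Hmod in S.
    rewrite S in R3. unfold q in *.
    unfold Re, Im in *; destruct (r z) as [x y], (r w) as [x' y']; cbn in *. nra. }
  replace (z * (0 * r z + q * dr z))%C with (q * (z * dr z))%C in HIm, HRe by ring.
  rewrite (Hode z Hz Hz0) in HIm, HRe.
  assert (S := sqr_Cmod (r z - RtoC rho)). rewrite Hmod in S.
  specialize (Hre z Hz). unfold q in HIm, HRe.
  unfold Re, Im in *; destruct (r z) as [x y], (h z) as [a b]; cbn in *.
  assert (S' : x * x + y * y = 2 * rho * x) by nra.
  assert (Hx : 0 <= x) by nra.
  (* On the circle |r|^2 = 2 rho Re r, so q r is rho times the conjugate of r; [HRe'] and [HIm'] are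
     the real and imaginary parts of q (c + 1 - (c + h) r) after this substitution. *)
  assert (HRe' : 0 <= (x - rho) * (c + 1) - rho * ((c + a) * x + b * y)).
  { replace ((x - rho) * (c + 1) - rho * ((c + a) * x + b * y)) with
      ((x - rho) * (c + 1) - (c + a) * (2 * rho * x - rho * x) - rho * b * y) by ring.
    rewrite <- S'. nra. }
  assert (HIm' : - y * (c + 1) - rho * (b * x - (c + a) * y) = 0).
  { replace (rho * (b * x - (c + a) * y)) with
      (b * (2 * rho * x - rho * x) - rho * (c + a) * y) by ring.
    rewrite <- S'. nra. }
  destruct Hx as [Hx|Hx].
  (* Subtracting y times the vanishing imaginary part eliminates Im h. What remains is negative
     because a = Re h > gamma. *)
  + assert (HK : x * ((x - rho) * (c + 1) - rho * ((c + a) * x + b * y)) =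
       rho * x * (c + 1 - 2 * rho * (c + a))).
    { transitivity (x * ((x - rho) * (c + 1) - rho * ((c + a) * x + b * y))
        - y * (- y * (c + 1) - rho * (b * x - (c + a) * y))); [rewrite HIm'; ring|].
      transitivity ((c + 1) * (x * x + y * y - rho * x)
        - rho * (c + a) * (x * x + y * y)); [ring|]. rewrite S'. ring. }
    assert (0 < rho * x) by nra.
    assert (c + 1 - 2 * rho * (c + a) < 0) by nra.
    nra.
  (* Contact at r = 0: the equation gives zr' = c + 1 while q = -rho, so the real part is -rho (c +
     1) < 0. *)
  + subst x. assert (y = 0) by nra. subst y. nra.
Qed.

(* K = H + zH' (Q/P)/(c + 1) for H = U/Q; at a first contact of Re H with beta,
   zH' is real, of the sign that puts Re K on the wrong side of beta. *)
Lemma bernardi_quotient_sign (c beta s : R) (P Q dQ U dU V K : C -> C) :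
  c > -1 ->
  (forall z : C, in_E z -> is_Cderive Q z (dQ z)) ->
  (forall z : C, in_E z -> is_Cderive U z (dU z)) ->
  Q 0%C = 1%C -> U 0%C = 1%C ->
  (forall z : C, in_E z -> P z <> 0%C) ->
  (forall z : C, in_E z -> Q z <> 0%C) ->
  (forall z : C, in_E z -> 0 <= Re (Q z / P z)%C) ->
  (forall z : C, in_E z ->
     (RtoC (c + 1) * Q z + z * dQ z = RtoC (c + 1) * P z)%C) ->
  (forall z : C, in_E z ->
     (RtoC (c + 1) * U z + z * dU z = RtoC (c + 1) * V z)%C) ->
  (forall z : C, in_E z -> z <> 0%C -> (K z * P z = V z)%C) ->
  (forall z : C, in_E z -> 0 < s * (Re (K z) - beta)) ->
  0 < s * (1 - beta) ->
  forall z : C, in_E z -> 0 < s * (Re (U z / Q z)%C - beta).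
Proof.
intros Hc HdQ HdU HQ0 HU0 HPn HQn Hr HQP HUV HK Hsgn Hs.
pose (H := fun z => (U z / Q z)%C).
pose (dH := fun z => ((dU z - U z / Q z * dQ z) / Q z)%C).
assert (HdH : forall z, in_E z -> is_Cderive H z (dH z)).
{ intros z Hz. apply is_Cderive_div; auto. }
assert (Hode : forall z, in_E z -> z <> 0%C ->
  (RtoC (c + 1) * K z)%C = (RtoC (c + 1) * H z + (z * dH z) * (Q z / P z))%C).
{ intros z Hz Hz0. unfold dH, H.
  assert (E1 := HQP z Hz). assert (E2 := HUV z Hz). assert (E3 := HK z Hz Hz0).
  assert (HP := HPn z Hz). assert (HQ := HQn z Hz).
  replace (z * ((dU z - U z / Q z * dQ z) / Q z))%C
    with ((z * dU z) / Q z - U z / Q z * (z * dQ z) / Q z)%C by (field; exact HQ).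
  replace (z * dQ z)%C with (RtoC (c + 1) * P z - RtoC (c + 1) * Q z)%C
    by (rewrite <- E1; ring).
  replace (z * dU z)%C with (RtoC (c + 1) * (K z * P z) - RtoC (c + 1) * U z)%C
    by (rewrite E3, <- E2; ring).
  field. auto. }
intros z Hz.
enough (- (s * (Re (H z) - beta)) < 0) by (unfold H in *; lra).
revert z Hz.
apply (negative_on_disk_by_first_contact (fun z => - (s * (Re (H z) - beta)))).
- intros z Hz eps Heps.
  assert (Hs1 := Rabs_pos s).
  destruct (is_Cderive_continuous H z (dH z) (HdH z Hz) (eps / (Rabs s + 1)))
    as [delta [Hd Hw]].
  { apply Rdiv_lt_0_compat; lra. }
  exists delta; split; [exact Hd|]. intros w Hw'. specialize (Hw w Hw').
  replace (- (s * (Re (H w) - beta)) - - (s * (Re (H z) - beta)))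
    with (- s * Re (H w - H z)%C) by (rewrite Re_minus; ring).
  rewrite Rabs_mult, Rabs_Ropp.
  assert (R1 := re_le_Cmod (H w - H z)).
  apply Rlt_div_r in Hw; [|lra].
  assert (R2 := Cmod_ge_0 (H w - H z)). assert (R3 := Rabs_pos (Re (H w - H z))).
  nra.
- unfold H. rewrite HU0, HQ0.
  replace (1 / 1)%C with (RtoC 1) by (field; intros E; injection E; lra).
  cbn. lra.
- intros z Hz Hz0 Hcontact Hle.
  destruct (radial_derivative_at_max (fun w => (RtoC (- s) * H w)%C) z
    (0 * H z + RtoC (- s) * dH z)%C) as [HIm HRe].
  { apply (is_Cderive_mult (fun _ => RtoC (- s)) H); [|now apply HdH].
    apply (is_derive_const (V := C_NormedModule) (RtoC (- s))). }
  { intros w Hw. specialize (Hle w Hw).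
    unfold Re in *; cbn in *. nra. }
  replace (z * (0 * H z + RtoC (- s) * dH z))%C
    with (RtoC (- s) * (z * dH z))%C in HIm, HRe by ring.
  assert (E := f_equal Re (Hode z Hz Hz0)).
  specialize (Hsgn z Hz). specialize (Hr z Hz).
  clearbody H dH. set (k := (z * dH z)%C) in *. set (r := (Q z / P z)%C) in *.
  unfold Re, Im in *. destruct k as [k1 k2], r as [r1 r2]; cbn in *.
  destruct (Req_dec s 0) as [->|Hs0]; [lra|].
  assert (k2 = 0) by nra. subst k2.
  (* At the contact s Re H = s beta, so only the term in zH' = k1 survives. The maximum of -s Re H
     gives -s k1 >= 0, and r1 >= 0, against the strict sign assumed for K. *)
  assert (Hk : (c + 1) * (s * (fst (K z) - beta)) = s * k1 * r1).
  { assert (s * fst (H z) = s * beta) by lra.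
    replace ((c + 1) * (s * (fst (K z) - beta))) with
     (s * ((c + 1) * fst (K z) - 0 * snd (K z)) - (c + 1) * (s * beta)) by ring.
    rewrite E. rewrite <- H0. ring. }
  assert (0 <= - (s * k1) * r1) by (apply Rmult_le_pos; lra).
  assert (0 < (c + 1) * (s * (fst (K z) - beta))) by (apply Rmult_lt_0_compat; lra).
  lra.
Qed.

(** * Power series on the unit disk *)

Notation is_Cseries a l :=
  (is_series (K := C_AbsRing) (V := C_NormedModule) a l) (only parsing).

Notation is_Cpseries a z l :=
  (is_pseries (K := C_AbsRing) (V := C_NormedModule) a z l) (only parsing).

(** The same definite description as in [L], so that [L n sigma f] is a [psum] by conversion. *)
Definition psum (a : nat -> C) (z : C) : C :=
  iota (T := C_CompleteNormedModule)
    (is_pseries (K := C_AbsRing) (V := C_NormedModule) a z).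

(* equivalent to a radius of convergence at least 1 *)
Definition subexponential (a : nat -> C) : Prop :=
  forall rho : R, 0 < rho < 1 -> exists M : R, forall k : nat, Cmod (a k) * rho ^ k <= M.

Definition shift (a : nat -> C) (k : nat) : C := a (S k).

Definition diff_coef (a : nat -> C) (k : nat) : C := (RtoC (INR (S k)) * a (S k))%C.

(** Restates at type [C] an equation typed in the carrier of a normed module, so that [ring] finds
    its structure. *)
Ltac C_eq := match goal with |- ?x = ?y => change (@eq C x y) end.

Lemma is_Cpseries_Cpow (a : nat -> C) (z l : C) :
  is_Cpseries a z l <-> is_Cseries (fun k => z ^ k * a k)%C l.
Proof.
assert (E : forall k, pow_n (K := C_AbsRing) z k = (z ^ k)%C).
{ induction k as [|k IH]; [reflexivity|]. cbn. now rewrite IH. }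
split; apply is_series_ext; intros k; [|symmetry];
  exact (f_equal (fun x => (x * a k)%C) (E k)).
Qed.

Lemma is_Cpseries_unique (a : nat -> C) (z l l' : C) :
  is_Cpseries a z l -> is_Cpseries a z l' -> l = l'.
Proof. apply (filterlim_locally_unique (V := C_NormedModule)). Qed.

Lemma psum_unique (a : nat -> C) (z l : C) : is_Cpseries a z l -> psum a z = l.
Proof.
intros H. apply (iota_unique (V := C_CompleteNormedModule)); [|exact H].
intros y Hy. now apply (is_Cpseries_unique a z).
Qed.

(** Convergence at the real point rho bounds the partial sums by some M; a term is a difference of
    two of them, hence at most 2M. *)
Lemma expands_subexponential (a : nat -> C) (f : C -> C) :
  expands a f -> subexponential a.
Proof.
intros H rho Hrho.
assert (Hs := H (RtoC rho)).
rewrite is_Cpseries_Cpow in Hs.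
destruct (filterlim_bounded (V := C_NormedModule)
  (sum_n (G := C_NormedModule) (fun k => RtoC rho ^ k * a k)%C)) as [M HM].
{ exists (f (RtoC rho)). apply Hs. unfold in_E. rewrite Cmod_R, Rabs_pos_eq; lra. }
exists (M + M); intros k.
replace (Cmod (a k) * rho ^ k) with (Cmod (RtoC rho ^ k * a k)).
2:{ rewrite Cmod_mult, Cmod_pow, Cmod_R, Rabs_pos_eq by lra. ring. }
assert (H0 := HM 0%nat). assert (N0 := Cmod_ge_0 (RtoC rho ^ 0 * a 0%nat)).
rewrite sum_O in H0. change (Cmod (RtoC rho ^ 0 * a 0%nat) <= M) in H0.
destruct k as [|k]; [lra|].
assert (H1 := HM k). assert (H2 := HM (S k)). rewrite sum_Sn in H2.
change (Cmod (sum_n (G := C_NormedModule) (fun k => RtoC rho ^ k * a k)%C k) <= M) in H1.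
change (Cmod (sum_n (G := C_NormedModule) (fun k => RtoC rho ^ k * a k)%C k
  + RtoC rho ^ S k * a (S k)) <= M) in H2.
set (u := sum_n _ k) in *. set (v := (RtoC rho ^ S k * a (S k))%C) in *.
assert (T := Cmod_sub_triangle v (- u)%C).
rewrite Cmod_opp in T. replace (v - - u)%C with (u + v)%C in T by ring. lra.
Qed.

(** Writing rho as the square of its root gives each factor its own radius, still below 1. *)
Lemma subexponential_mult (a b : nat -> C) :
  subexponential a -> subexponential b -> subexponential (fun k => a k * b k)%C.
Proof.
intros Ha Hb rho Hrho.
assert (Hs : 0 < sqrt rho < 1).
{ split; [apply sqrt_lt_R0; lra|].
  apply Rlt_le_trans with (sqrt 1); [apply sqrt_lt_1_alt | rewrite sqrt_1]; lra. }
destruct (Ha _ Hs) as [A HA]. destruct (Hb _ Hs) as [B HB].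
exists (A * B); intros k.
rewrite <- (sqrt_sqrt rho) at 1 by lra.
rewrite Cmod_mult, Rpow_mult_distr.
replace (Cmod (a k) * Cmod (b k) * (sqrt rho ^ k * sqrt rho ^ k))
  with ((Cmod (a k) * sqrt rho ^ k) * (Cmod (b k) * sqrt rho ^ k)) by ring.
assert (0 <= sqrt rho ^ k) by (apply pow_le; lra).
apply Rmult_le_compat; auto; apply Rmult_le_pos; auto; apply Cmod_ge_0.
Qed.

Lemma subexponential_shift (a : nat -> C) :
  subexponential a -> subexponential (shift a).
Proof.
intros H rho Hrho. destruct (H rho Hrho) as [M HM].
exists (M / rho); intros k. apply -> Rle_div_r; [|lra].
specialize (HM (S k)). cbn in HM. unfold shift. lra.
Qed.

Lemma subexponential_bounded (a : nat -> C) (M : R) :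
  (forall k : nat, Cmod (a k) <= M) -> subexponential a.
Proof.
intros H rho Hrho. exists M; intros k.
apply Rle_trans with (2 := H k).
rewrite <- (Rmult_1_r (Cmod (a k))) at 2.
apply Rmult_le_compat_l; [apply Cmod_ge_0|].
rewrite <- (pow1 k). apply pow_incr. lra.
Qed.

(** Bernoulli's inequality for (1 + x)^k with 1 + x = 1/rho. *)
Lemma subexponential_INR : subexponential (fun k => RtoC (INR k)).
Proof.
intros rho Hrho.
pose (x := / rho - 1).
assert (Hx : 0 < x).
{ unfold x. assert (1 < / rho); [|lra]. rewrite <- Rinv_1. apply Rinv_lt_contravar; lra. }
exists (/ x); intros k.
assert (P := poly k x Hx).
rewrite Cmod_R, Rabs_pos_eq by apply pos_INR.
replace (1 + x) with (/ rho) in P by (unfold x; ring).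
rewrite pow_inv in P.
assert (Hp : 0 < rho ^ k) by (apply pow_lt; lra).
assert (E : / rho ^ k * rho ^ k = 1) by (field; lra).
apply (Rmult_le_reg_r x); [exact Hx|].
rewrite Rinv_l by lra. nra.
Qed.

Lemma subexponential_pow (w : nat -> R) (n : nat) :
  subexponential (fun k => RtoC (w k)) -> subexponential (fun k => RtoC (w k ^ n)).
Proof.
intros H. induction n as [|n IH].
- apply (subexponential_bounded _ 1). intros k. cbn. rewrite Cmod_1. lra.
- intros rho Hrho. destruct (subexponential_mult _ _ H IH rho Hrho) as [M HM].
  exists M; intros k. cbn. now rewrite RtoC_mult.
Qed.

Lemma subexponential_le (w v : nat -> R) :
  (forall k : nat, 0 <= w k <= v k) ->
  subexponential (fun k => RtoC (v k)) -> subexponential (fun k => RtoC (w k)).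
Proof.
intros Hle H rho Hrho. destruct (H rho Hrho) as [M HM].
exists M; intros k. apply Rle_trans with (2 := HM k).
apply Rmult_le_compat_r; [apply pow_le; lra|].
specialize (Hle k). rewrite !Cmod_R, !Rabs_pos_eq; lra.
Qed.

Lemma subexponential_INR_succ : subexponential (fun k => RtoC (INR (S k))).
Proof. exact (subexponential_shift _ subexponential_INR). Qed.

(** The sign of sigma is arbitrary. Both 2/(k+1) and its inverse are at most 2(k+1), so the weight
    is bounded by 2(k+1) to the power |sigma|, then to a natural exponent above it. *)
Lemma subexponential_Rpower (sigma : R) :
  subexponential (fun k => RtoC (Rpower (2 / (INR k + 1)) sigma)).
Proof.
destruct (nfloor_ex (Rabs sigma)) as [N [_ HN]]; [apply Rabs_pos|].
apply (subexponential_le _ (fun k => (2 * INR (S k)) ^ S N)).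
- intros k. split; [apply Rlt_le, exp_pos|].
  assert (Hk := pos_INR k). rewrite S_INR.
  rewrite <- Rpower_pow by lra.
  unfold Rpower. apply Rnot_lt_le. intros Hlt. apply exp_lt_inv in Hlt.
  revert Hlt. apply Rle_not_lt.
  assert (H1 : ln (2 / (INR k + 1)) <= ln (2 * (INR k + 1))).
  { apply ln_le; [apply Rdiv_lt_0_compat; lra|]. apply Rle_div_l; nra. }
  assert (H2 : - ln (2 / (INR k + 1)) <= ln (2 * (INR k + 1))).
  { rewrite <- ln_Rinv by (apply Rdiv_lt_0_compat; lra).
    apply ln_le; [apply Rinv_0_lt_compat, Rdiv_lt_0_compat; lra|].
    replace (/ (2 / (INR k + 1))) with ((INR k + 1) / 2) by (field; lra). lra. }
  apply Rle_trans with (Rabs sigma * ln (2 * (INR k + 1))).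
  + apply Rle_trans with (1 := Rle_abs _). rewrite Rabs_mult.
    apply Rmult_le_compat_l; [apply Rabs_pos|]. apply Rabs_le_between. lra.
  + rewrite S_INR. apply Rmult_le_compat_r; lra.
- apply subexponential_pow.
  intros rho Hrho.
  assert (H2 : subexponential (fun _ => RtoC 2)).
  { apply (subexponential_bounded _ 2). intros _. rewrite Cmod_R, Rabs_pos_eq; lra. }
  destruct (subexponential_mult _ _ H2 subexponential_INR_succ rho Hrho) as [M HM].
  exists M; intros k. now rewrite RtoC_mult.
Qed.

Lemma subexponential_diff_coef (a : nat -> C) :
  subexponential a -> subexponential (diff_coef a).
Proof.
intros H. apply (subexponential_mult _ (shift a)).
- apply subexponential_INR_succ.
- now apply subexponential_shift.
Qed.

(** Comparison with a geometric series of ratio r/rho, where rho is the midpoint of r and 1. *)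
Lemma subexponential_ex_series (a : nat -> C) (r : R) :
  subexponential a -> 0 <= r < 1 -> ex_series (fun k => Cmod (a k) * r ^ k).
Proof.
intros H Hr.
pose (rho := (1 + r) / 2).
destruct (H rho) as [M HM]; [unfold rho; lra|].
apply (ex_series_le (K := R_AbsRing) (V := R_CompleteNormedModule) _
  (fun k => M * (r / rho) ^ k)).
- intros k. change (Rabs (Cmod (a k) * r ^ k) <= M * (r / rho) ^ k).
  assert (P1 : 0 <= r ^ k) by (apply pow_le; lra).
  assert (P2 : 0 < rho ^ k) by (apply pow_lt; unfold rho; lra).
  assert (P3 := Cmod_ge_0 (a k)).
  rewrite Rabs_pos_eq by now apply Rmult_le_pos.
  unfold Rdiv. rewrite Rpow_mult_distr, pow_inv.
  replace (Cmod (a k) * r ^ k) with ((Cmod (a k) * rho ^ k) * (r ^ k * / rho ^ k))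
    by (field; lra).
  apply Rmult_le_compat_r; [|apply HM].
  apply Rmult_le_pos; [exact P1|]. apply Rlt_le, Rinv_0_lt_compat, P2.
- apply (ex_series_scal_l (K := R_AbsRing) M (fun k => (r / rho) ^ k)).
  apply ex_series_geom.
  assert (0 < / rho) by (apply Rinv_0_lt_compat; unfold rho; lra).
  assert (0 <= r / rho) by (apply Rmult_le_pos; lra).
  rewrite Rabs_pos_eq by assumption.
  apply Rlt_div_l; unfold rho; lra.
Qed.

Lemma psum_correct (a : nat -> C) (z : C) :
  subexponential a -> in_E z -> is_Cpseries a z (psum a z).
Proof.
intros H Hz.
destruct (ex_series_le (K := C_AbsRing) (V := C_CompleteNormedModule)
  (fun k => z ^ k * a k)%C (fun k => Cmod (a k) * Cmod z ^ k)) as [l Hl].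
- intros k. change (Cmod (z ^ k * a k) <= Cmod (a k) * Cmod z ^ k).
  rewrite Cmod_mult, Cmod_pow. lra.
- apply subexponential_ex_series; [exact H|]. split; [apply Cmod_ge_0|exact Hz].
- assert (Hl' : is_Cpseries a z l) by now apply is_Cpseries_Cpow.
  now rewrite (psum_unique a z l Hl').
Qed.

Lemma Cseries_norm_le (a : nat -> C) (b : nat -> R) (l : C) (B : R) :
  is_Cseries a l -> is_series b B -> (forall k : nat, Cmod (a k) <= b k) -> Cmod l <= B.
Proof.
intros Ha Hb Hle.
apply (is_lim_seq_le (fun n => norm (sum_n (G := C_NormedModule) a n)) (sum_n b) (Cmod l) B).
- intros n. apply Rle_trans with (1 := norm_sum_n_m (V := C_NormedModule) a 0 n).
  apply sum_n_m_le. exact Hle.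
- apply (filterlim_comp _ _ _ (sum_n (G := C_NormedModule) a) norm _ _ _ Ha).
  apply (filterlim_norm (V := C_NormedModule)).
- exact Hb.
Qed.

(** Induction on the remainder: e_(k+1) = w e_k + (w - z)^2 k z^(k-1), together with k^2 + k <=
    (k+1)^2. The factor rho^2 on the left avoids the exponent k - 2. *)
Lemma pow_second_order (z w : C) (rho : R) (k : nat) :
  Cmod z <= rho -> Cmod w <= rho ->
  rho * rho * Cmod (w ^ k - z ^ k - (w - z) * (RtoC (INR k) * z ^ pred k))
  <= Cmod (w - z) * Cmod (w - z) * (INR k * INR k * rho ^ k).
Proof.
intros Hz Hw.
assert (Nz := Cmod_ge_0 z). assert (Nw := Cmod_ge_0 w).
assert (Nd := Cmod_ge_0 (w - z)).
induction k as [|k IH].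
- replace (w ^ 0 - z ^ 0 - (w - z) * (RtoC (INR 0) * z ^ pred 0))%C with (RtoC 0)
    by (cbn; ring).
  rewrite Cmod_0. cbn. lra.
- set (e := (w ^ k - z ^ k - (w - z) * (RtoC (INR k) * z ^ pred k))%C) in *.
  replace (w ^ S k - z ^ S k - (w - z) * (RtoC (INR (S k)) * z ^ pred (S k)))%C
    with (w * e + (w - z) * (w - z) * (RtoC (INR k) * z ^ pred k))%C.
  2:{ unfold e. rewrite S_INR, RtoC_plus. destruct k as [|k]; cbn; ring. }
  assert (Hk := pos_INR k). assert (He := Cmod_ge_0 e).
  assert (Hr : 0 <= rho ^ k) by (apply pow_le; lra).
  assert (Hp : rho * rho * (INR k * Cmod z ^ pred k) <= INR k * (rho * rho ^ k)).
  { destruct k as [|k]; [cbn; lra|].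
    replace (INR (S k) * (rho * rho ^ S k)) with (rho * rho * (INR (S k) * rho ^ k))
      by (cbn [pow]; ring).
    apply Rmult_le_compat_l; [nra|]. apply Rmult_le_compat_l; [exact Hk|].
    apply pow_incr. lra. }
  apply Rle_trans with (rho * (rho * rho * Cmod e)
    + Cmod (w - z) * Cmod (w - z) * (rho * rho * (INR k * Cmod z ^ pred k))).
  + replace (rho * (rho * rho * Cmod e)
      + Cmod (w - z) * Cmod (w - z) * (rho * rho * (INR k * Cmod z ^ pred k)))
    with (rho * rho * (rho * Cmod e + Cmod (w - z) * Cmod (w - z) * (INR k * Cmod z ^ pred k)))
      by ring.
    apply Rmult_le_compat_l; [nra|].
    apply Rle_trans with (1 := Cmod_triangle _ _).
    rewrite !Cmod_mult, Cmod_pow, Cmod_R, (Rabs_pos_eq _ Hk).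
    apply Rplus_le_compat_r. nra.
  + set (d2 := Cmod (w - z) * Cmod (w - z)) in *.
    assert (0 <= d2) by (unfold d2; nra).
    apply Rle_trans with (rho * (d2 * (INR k * INR k * rho ^ k)) + d2 * (INR k * (rho * rho ^ k))).
    * apply Rplus_le_compat; apply Rmult_le_compat_l; assumption || lra.
    * rewrite S_INR. cbn [pow].
      replace (rho * (d2 * (INR k * INR k * rho ^ k)) + d2 * (INR k * (rho * rho ^ k)))
        with (d2 * (rho * rho ^ k) * (INR k * INR k + INR k)) by ring.
      replace (d2 * ((INR k + 1) * (INR k + 1) * (rho * rho ^ k)))
        with (d2 * (rho * rho ^ k) * ((INR k + 1) * (INR k + 1))) by ring.
      apply Rmult_le_compat_l; [|lra].
      apply Rmult_le_pos; [assumption|]. apply Rmult_le_pos; lra.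
Qed.

(** Indexes the derived series like the original one, so that the two can be added term by term; the
    factor [INR 0] kills the term where [pred 0] is 0. *)
Lemma is_Cseries_diff (a : nat -> C) (z l : C) :
  is_Cpseries (diff_coef a) z l ->
  is_Cseries (fun k => RtoC (INR k) * z ^ pred k * a k)%C l.
Proof.
rewrite is_Cpseries_Cpow; intros H.
apply is_series_decr_1.
replace (plus l _) with (l : C_NormedModule).
2:{ unfold plus, opp; cbn. ring. }
revert H. apply is_series_ext. intros k. C_eq. unfold diff_coef. cbn [pred]. ring.
Qed.

(** Summing the second-order remainders of the powers bounds the error by |w - z|^2 T / rho^2, where
    T is the sum of k^2 |a_k| rho^k for a radius rho between |z| and 1. *)
Lemma psum_derive (a : nat -> C) (z : C) :
  subexponential a -> in_E z -> is_Cderive (psum a) z (psum (diff_coef a) z).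
Proof.
intros Ha Hz. unfold in_E in Hz. assert (Nz := Cmod_ge_0 z).
pose (rho := (1 + Cmod z) / 2).
assert (Hrho : 0 < rho < 1) by (unfold rho; lra).
destruct (subexponential_ex_series
  (fun k => RtoC (INR k) * RtoC (INR k) * a k)%C rho) as [T HT]; [|lra|].
{ apply subexponential_mult; [|exact Ha].
  apply subexponential_mult; apply subexponential_INR. }
assert (HT' : is_series (fun k => INR k * INR k * Cmod (a k) * rho ^ k) T).
{ revert HT. apply is_series_ext. intros k.
  rewrite !Cmod_mult, Cmod_R, Rabs_pos_eq by apply pos_INR. reflexivity. }
assert (HD := is_Cseries_diff _ _ _
  (psum_correct (diff_coef a) z (subexponential_diff_coef a Ha) Hz)).
assert (HS := psum_correct a z Ha Hz).
rewrite is_Cpseries_Cpow in HS.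
assert (Hrho2 : 0 < rho * rho) by nra.
assert (Hexp : forall w, Cmod (w - z) < (1 - Cmod z) / 2 ->
  Cmod (psum a w - psum a z - (w - z) * psum (diff_coef a) z)
  <= Cmod (w - z) * Cmod (w - z) / (rho * rho) * T).
{ intros w Hw.
  assert (Tr := Cmod_sub_triangle w z).
  assert (Hwrho : Cmod w <= rho) by (unfold rho; lra).
  assert (HW := psum_correct a w Ha ltac:(unfold in_E; lra)).
  rewrite is_Cpseries_Cpow in HW.
  apply (Cseries_norm_le
    (fun k => (w ^ k - z ^ k - (w - z) * (RtoC (INR k) * z ^ pred k)) * a k)%C
    (fun k => Cmod (w - z) * Cmod (w - z) / (rho * rho)
              * (INR k * INR k * Cmod (a k) * rho ^ k))).
  - assert (H1 := is_series_minus _ _ _ _ (is_series_minus _ _ _ _ HW HS)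
      (is_series_scal (w - z)%C _ _ HD)).
    revert H1. apply is_series_ext. intros k.
    unfold plus, opp, scal; cbn. unfold mult; cbn. ring.
  - exact (is_series_scal (V := R_NormedModule) _ _ _ HT').
  - intros k. rewrite Cmod_mult.
    assert (P := pow_second_order z w rho k ltac:(unfold rho; lra) Hwrho).
    assert (Na := Cmod_ge_0 (a k)).
    replace (Cmod (w - z) * Cmod (w - z) / (rho * rho) * (INR k * INR k * Cmod (a k) * rho ^ k))
      with (Cmod (w - z) * Cmod (w - z) * (INR k * INR k * rho ^ k) / (rho * rho) * Cmod (a k))
      by (field; lra).
    apply Rmult_le_compat_r; [exact Na|]. apply Rle_div_r; lra. }
assert (T0 : 0 <= T).
{ assert (Hpos : forall k, 0 <= INR k * INR k * Cmod (a k) * rho ^ k).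
  { intros k. assert (Hk := pos_INR k). assert (Na := Cmod_ge_0 (a k)).
    assert (0 <= rho ^ k) by (apply pow_le; lra).
    repeat apply Rmult_le_pos; assumption. }
  apply (is_lim_seq_le (fun _ => 0) _ 0 T) with (3 := HT'); [|apply is_lim_seq_const].
  intros n. induction n as [|n IH].
  - rewrite sum_O. apply Hpos.
  - rewrite sum_Sn. apply Rplus_le_le_0_compat; [exact IH|apply Hpos]. }
apply is_Cderive_eps. intros eps Heps.
exists (Rmin ((1 - Cmod z) / 2) (eps * (rho * rho) / (T + 1))); split.
{ apply Rmin_pos; [lra|]. apply Rdiv_lt_0_compat; nra. }
intros w Hw.
assert (H1 := Rlt_le_trans _ _ _ Hw (Rmin_l _ _)).
assert (H2 := Rlt_le_trans _ _ _ Hw (Rmin_r _ _)).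
apply Rle_trans with (1 := Hexp w H1).
assert (Nw := Cmod_ge_0 (w - z)).
apply Rlt_div_r in H2; [|lra].
replace (Cmod (w - z) * Cmod (w - z) / (rho * rho) * T)
  with (Cmod (w - z) * T / (rho * rho) * Cmod (w - z)) by (field; lra).
apply Rmult_le_compat_r; [exact Nw|].
apply Rle_div_l; nra.
Qed.

Lemma psum_at_0 (a : nat -> C) : psum a 0%C = a 0%nat.
Proof. apply psum_unique, (is_pseries_0 (V := C_NormedModule)). Qed.

Lemma psum_ext (a b : nat -> C) (z : C) : (forall k : nat, a k = b k) ->
  subexponential b -> in_E z -> psum a z = psum b z.
Proof.
intros E Hb Hz. apply psum_unique.
apply (is_pseries_ext (V := C_NormedModule) b); [intros k; now rewrite E|].
now apply psum_correct.
Qed.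

Lemma psum_shift (a : nat -> C) (z : C) :
  subexponential a -> in_E z -> psum a z = (a 0%nat + z * psum (shift a) z)%C.
Proof.
intros Ha Hz. apply psum_unique.
assert (H := psum_correct _ z (subexponential_shift a Ha) Hz).
rewrite is_Cpseries_Cpow in *.
apply is_series_decr_1.
match goal with |- is_series _ ?l => replace l with (z * psum (shift a) z)%C end.
2:{ unfold plus, opp; cbn. ring. }
assert (H1 := is_series_scal (V := C_NormedModule) z _ _ H).
revert H1. apply is_series_ext. intros k. C_eq. unfold shift. cbn [Cpow].
change (z * (z ^ k * a (S k)) = z * z ^ k * a (S k))%C. ring.
Qed.

(* termwise: (d + k) b_k = e a_k gives d B + z B' = e A *)
Lemma psum_euler (d e : R) (a b : nat -> C) (z : C) :
  subexponential a -> subexponential b -> in_E z ->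
  (forall k : nat, (RtoC (d + INR k) * b k = RtoC e * a k)%C) ->
  (RtoC d * psum b z + z * psum (diff_coef b) z = RtoC e * psum a z)%C.
Proof.
intros Ha Hb Hz E.
assert (H1 := psum_correct a z Ha Hz). assert (H2 := psum_correct b z Hb Hz).
assert (H3 := is_Cseries_diff _ _ _
  (psum_correct (diff_coef b) z (subexponential_diff_coef b Hb) Hz)).
rewrite is_Cpseries_Cpow in H1, H2.
apply (filterlim_locally_unique (V := C_NormedModule) (F := eventually)
  (sum_n (G := C_NormedModule) (fun k => RtoC e * (z ^ k * a k))%C)).
2:{ exact (is_series_scal (V := C_NormedModule) (RtoC e) _ _ H1). }
assert (H4 := is_series_plus (V := C_NormedModule) _ _ _ _
  (is_series_scal (V := C_NormedModule) (RtoC d) _ _ H2)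
  (is_series_scal (V := C_NormedModule) z _ _ H3)).
revert H4. apply (is_series_ext (V := C_NormedModule)). intros k. C_eq.
replace (RtoC e * (z ^ k * a k))%C with (z ^ k * (RtoC (d + INR k) * b k))%C
  by (rewrite E; ring).
rewrite RtoC_plus. change (RtoC d * (z ^ k * b k) + z * (RtoC (INR k) * z ^ pred k * b k)
  = z ^ k * ((RtoC d + RtoC (INR k)) * b k))%C.
destruct k as [|k]; cbn [pred Cpow]; [cbn [INR]|]; ring.
Qed.

(** The value at 0 gives a_0 = 0; then z times the shifted series is zero, so that series vanishes
    off 0, and at 0 by continuity, which lets the induction continue. *)
Lemma psum_zero_coef (a : nat -> C) : subexponential a ->
  (forall z : C, in_E z -> psum a z = 0%C) -> forall k : nat, a k = 0%C.
Proof.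
intros Ha H k. revert a Ha H.
induction k as [|k IH]; intros a Ha H;
  assert (a0 : a 0%nat = 0%C) by (rewrite <- psum_at_0; apply H; unfold in_E; rewrite Cmod_0; lra).
{ exact a0. }
apply (IH (shift a)); [now apply subexponential_shift|].
assert (Hne : forall z, in_E z -> z <> 0%C -> psum (shift a) z = 0%C).
{ intros z Hz Hz0. assert (E := psum_shift a z Ha Hz).
  rewrite (H z Hz), a0 in E.
  replace (psum (shift a) z) with ((0 + z * psum (shift a) z) / z)%C by (field; exact Hz0).
  rewrite <- E. field. exact Hz0. }
intros z Hz.
destruct (Req_dec (Cmod z) 0) as [Hz0|Hz0].
2:{ apply Hne; [exact Hz|]. intros ->. now rewrite Cmod_0 in Hz0. }
apply Cmod_eq_0.
destruct (Rle_lt_dec (Cmod (psum (shift a) z)) 0) as [Hle|Hlt].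
{ apply Rle_antisym; [exact Hle|apply Cmod_ge_0]. }
exfalso.
destruct (is_Cderive_continuous _ _ _
  (psum_derive (shift a) z (subexponential_shift a Ha) Hz) _ Hlt) as [delta [Hd Hw]].
apply Cmod_eq_0 in Hz0. subst z.
pose (t := Rmin (1 / 2) (delta / 2)).
assert (t1 : t <= 1 / 2) by apply Rmin_l. assert (t2 : t <= delta / 2) by apply Rmin_r.
assert (t0 : 0 < t) by (apply Rmin_pos; lra).
specialize (Hw (RtoC t)). rewrite (Hne (RtoC t)) in Hw.
- replace (RtoC t - 0)%C with (RtoC t) in Hw by ring.
  rewrite Cmod_R, Rabs_pos_eq, Cmod_sub_sym in Hw by lra.
  replace (psum (shift a) 0 - 0)%C with (psum (shift a) 0) in Hw by ring.
  specialize (Hw ltac:(lra)). lra.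
- unfold in_E. rewrite Cmod_R, Rabs_pos_eq; lra.
- intros E. apply RtoC_inj in E. lra.
Qed.

Lemma expands_unique (a b : nat -> C) (f : C -> C) :
  expands a f -> expands b f -> forall k : nat, a k = b k.
Proof.
intros Ha Hb k.
assert (Hab : forall z, in_E z -> is_Cpseries (fun k => (a k - b k)%C) z (RtoC 0)).
{ intros z Hz.
  assert (H := is_series_minus (V := C_NormedModule) _ _ _ _ (Ha z Hz) (Hb z Hz)).
  replace (RtoC 0) with (f z - f z)%C by ring.
  revert H. apply (is_series_ext (V := C_NormedModule)). intros j. C_eq.
  change (pow_n (K := C_AbsRing) z j * a j - pow_n (K := C_AbsRing) z j * b j
    = pow_n (K := C_AbsRing) z j * (a j - b j))%C. ring. }
assert (E : (a k - b k)%C = 0%C).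
{ apply (psum_zero_coef (fun k => (a k - b k)%C)).
  - now apply (expands_subexponential _ (fun _ => 0%C)).
  - intros z Hz. now apply psum_unique, Hab. }
replace (a k) with (a k - b k + b k)%C by ring. rewrite E. ring.
Qed.

Lemma expands_coef (a : nat -> C) (f : C -> C) :
  expands a f -> forall k : nat, coef f k = a k.
Proof.
intros Ha k. unfold coef. apply (iota_unique (V := C_CompleteNormedModule)).
- intros y [b [Hb ->]]. now apply (expands_unique b a f).
- now exists a.
Qed.

Lemma expands_eq_psum (a : nat -> C) (f : C -> C) (z : C) :
  expands a f -> in_E z -> f z = psum a z.
Proof. intros H Hz. symmetry. now apply psum_unique, H. Qed.

(** * The Bernardi integral as a power series *)

Lemma is_Cpath_derive_Rmult (u : R -> R) (f : R -> C) (t du : R) (df : C) :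
  is_derive u t du -> is_Cpath_derive f t df ->
  is_Cpath_derive (fun s => RtoC (u s) * f s)%C t (RtoC du * f t + RtoC (u t) * df)%C.
Proof.
intros Hu Hf.
assert (H := filterdiff_scal_fct (K := R_AbsRing) (U := R_NormedModule)
  (V := C_R_NormedModule) t u f _ _ Rmult_comm Hu Hf).
apply (filterdiff_ext_lin (K := R_AbsRing) (U := R_NormedModule) (V := C_R_NormedModule)
  _ (fun y : R => plus (scal (scal y du) (f t)) (scal (u t) (scal y df)) : C_R_NormedModule)).
- revert H. apply filterdiff_ext. intros s.
  apply injective_projections; cbn; unfold scal; cbn; unfold mult; cbn; ring.
- intros y. apply injective_projections; cbn; unfold scal, plus; cbn; unfold mult; cbn; ring.
Qed.

Lemma Rdiv_Cmod_sqr (z : C) : z <> 0%C ->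
  1 - (Re z / Cmod z) * (Re z / Cmod z) = (Im z / Cmod z) * (Im z / Cmod z).
Proof.
intros Hz. apply Cmod_gt_0 in Hz.
assert (S := Cmod2_alt z).
replace 1 with (Cmod z ^ 2 / Cmod z ^ 2) by (field; lra).
rewrite S at 1. field. lra.
Qed.

Lemma cos_Carg (z : C) : z <> 0%C -> cos (Carg z) = Re z / Cmod z.
Proof.
intros Hz. assert (S := Rdiv_Cmod_sqr z Hz).
assert (H : -1 <= Re z / Cmod z <= 1) by nra.
unfold Carg. destruct (Rlt_dec (Im z) 0); [rewrite cos_neg|]; now apply cos_acos.
Qed.

Lemma sin_Carg (z : C) : z <> 0%C -> sin (Carg z) = Im z / Cmod z.
Proof.
intros Hz. assert (S := Rdiv_Cmod_sqr z Hz).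
assert (H : -1 <= Re z / Cmod z <= 1) by nra.
apply Cmod_gt_0 in Hz. apply Rinv_0_lt_compat in Hz.
unfold Carg. destruct (Rlt_dec (Im z) 0) as [Hneg|Hpos];
  [rewrite sin_neg|]; rewrite sin_acos by exact H; unfold Rsqr; rewrite S.
- replace (Im z / Cmod z * (Im z / Cmod z)) with
    ((- (Im z / Cmod z)) * (- (Im z / Cmod z))) by ring.
  rewrite sqrt_square; [ring|]. unfold Rdiv. nra.
- rewrite sqrt_square; [ring|]. unfold Rdiv. nra.
Qed.

Lemma Crpow_neq_0 (z : C) (e : R) : Crpow z e <> 0%C.
Proof.
unfold Crpow. apply Cmult_neq_0.
- intros E. apply RtoC_inj in E. revert E. apply Rgt_not_eq, exp_pos.
- intros E. injection E as E1 E2.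
  assert (S := sin2_cos2 (e * Carg z)). unfold Rsqr in S. nra.
Qed.

Lemma Crpow_succ (z : C) (e : R) : z <> 0%C -> (z * Crpow z (e - 1))%C = Crpow z e.
Proof.
intros Hz. assert (Hc := cos_Carg z Hz). assert (Hs := sin_Carg z Hz).
apply Cmod_gt_0 in Hz.
unfold Crpow.
replace (Rpower (Cmod z) e) with (Cmod z * Rpower (Cmod z) (e - 1)).
2:{ rewrite <- (Rpower_1 (Cmod z) Hz) at 1. rewrite <- Rpower_plus. f_equal. ring. }
replace (cos (e * Carg z)) with (cos ((e - 1) * Carg z + Carg z)) by (f_equal; ring).
replace (sin (e * Carg z)) with (sin ((e - 1) * Carg z + Carg z)) by (f_equal; ring).
rewrite cos_plus, sin_plus, Hc, Hs.
unfold Re, Im. destruct z as [x y]; set (m := Cmod (x, y)) in *.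
apply injective_projections; cbn; field; lra.
Qed.

(** Positive scaling fixes the argument, so along a segment from 0 the complex power is a real power
    times a constant. *)
Lemma Crpow_Rmult (s e : R) (z : C) : 0 < s -> z <> 0%C ->
  Crpow (RtoC s * z) e = (RtoC (Rpower s e) * Crpow z e)%C.
Proof.
intros Hs Hz. apply Cmod_gt_0 in Hz.
assert (Em : Cmod (RtoC s * z) = s * Cmod z).
{ rewrite Cmod_mult, Cmod_R, Rabs_pos_eq; lra. }
assert (Ea : Carg (RtoC s * z) = Carg z).
{ unfold Carg. rewrite Em.
  replace (Re (RtoC s * z)) with (s * Re z) by (unfold Re; cbn; ring).
  replace (Im (RtoC s * z)) with (s * Im z) by (unfold Im; cbn; ring).
  replace (s * Re z / (s * Cmod z)) with (Re z / Cmod z) by (field; lra).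
  destruct (Rlt_dec (s * Im z) 0), (Rlt_dec (Im z) 0); try reflexivity; exfalso; nra. }
unfold Crpow. rewrite Ea, Em, <- Rpower_mult_distr, RtoC_mult by lra. ring.
Qed.

Lemma is_derive_Rpower (e t : R) : 0 < t ->
  is_derive (fun s => Rpower s e) t (e * Rpower t (e - 1)).
Proof. intros Ht. now apply is_derive_Reals, derivable_pt_lim_power. Qed.

Lemma Rpower_small (e eps : R) : 0 < e -> 0 < eps ->
  exists delta : R, 0 < delta /\ forall s : R, 0 < s < delta -> Rpower s e < eps.
Proof.
intros He Heps. exists (Rpower eps (/ e)); split; [apply exp_pos|].
intros s Hs. apply Rlt_le_trans with (Rpower (Rpower eps (/ e)) e).
- apply Rlt_Rpower_l; lra.
- rewrite Rpower_mult, Rinv_l, Rpower_1; lra.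
Qed.

(* [s ^ c k G(sz)] is a primitive of the integrand, as cG + wG' = f at w = sz,
   and it is O(s ^ (c + 1)) at 0 *)
Lemma seg_integral_Crpow (c : R) (f G dG : C -> C) (z : C) :
  c > -1 -> in_E z -> z <> 0%C -> G 0%C = 0%C ->
  (forall w : C, in_E w -> is_Cderive G w (dG w)) ->
  (forall w : C, in_E w -> exists d : C, is_Cderive f w d) ->
  (forall w : C, in_E w -> (RtoC c * G w + w * dG w = f w)%C) ->
  seg_integral (fun t => Crpow t (c - 1) * f t)%C z = (Crpow z c * G z)%C.
Proof.
intros Hc Hz Hz0 HG0 HdG Hdf HGf.
unfold seg_integral. rewrite <- (Crpow_succ z c Hz0), <- Cmult_assoc. f_equal.
set (K := Crpow z (c - 1)).
assert (Hray : forall s, 0 < s <= 1 -> in_E (RtoC s * z)).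
{ intros s Hs. unfold in_E in *. rewrite Cmod_mult, Cmod_R, Rabs_pos_eq by lra.
  assert (N := Cmod_ge_0 z). nra. }
pose (Phi := fun s => (RtoC (Rpower s c) * (K * G (RtoC s * z)))%C).
pose (phi := fun s => (RtoC (Rpower s (c - 1)) * (K * f (RtoC s * z)))%C).
assert (HK : forall F w d, is_Cderive F w d -> is_Cderive (fun w => K * F w)%C w (K * d)%C).
{ intros F w d HF.
  replace (K * d)%C with (0 * F w + K * d)%C by ring.
  apply (is_Cderive_mult (fun _ => K) F); [|exact HF].
  apply (is_derive_const (V := C_NormedModule) K). }
assert (HPhi : forall s, 0 < s <= 1 -> is_Cpath_derive Phi s (phi s)).
{ intros s Hs.
  assert (H := is_Cpath_derive_Rmult _ _ s _ _ (is_derive_Rpower c s ltac:(lra))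
    (is_Cderive_ray _ z _ s (HK G _ _ (HdG _ (Hray s Hs))))).
  cbv beta in H. unfold phi. rewrite <- (HGf _ (Hray s Hs)).
  (* Factoring s out of s^c leaves s^(c-1) K (cG + wG') at w = sz, which is [phi s]. *)
  replace (Rpower s c) with (s * Rpower s (c - 1)) in H.
  2:{ rewrite <- (Rpower_1 s) at 1 by lra. rewrite <- Rpower_plus. f_equal. ring. }
  rewrite !RtoC_mult in H.
  match type of H with is_derive _ _ ?l =>
    match goal with |- is_derive _ _ ?r => replace r with l; [exact H|] end end.
  C_eq. ring. }
assert (Hphi : forall s, 0 < s <= 1 -> continuous (U := C_R_NormedModule) phi s).
{ intros s Hs. destruct (Hdf _ (Hray s Hs)) as [d Hd].
  apply (ex_derive_continuous (V := C_R_NormedModule)).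
  eexists. apply (is_Cpath_derive_Rmult _ _ s).
  - apply is_derive_Rpower; lra.
  - exact (is_Cderive_ray _ z _ s (HK f _ _ Hd)). }
apply (is_RInt_gen_unique (V := C_R_CompleteNormedModule)).
intros P HP. apply (locally_C (K * G z)%C P) in HP. destruct HP as [eps HP].
destruct (is_Cderive_lipschitz _ _ _ (HdG 0%C ltac:(unfold in_E; rewrite Cmod_0; lra)))
  as [d1 [Hd1 HL]].
set (B := Cmod (dG 0%C) + 1) in *.
assert (HB : 0 < B) by (unfold B; assert (N := Cmod_ge_0 (dG 0%C)); lra).
assert (Nz : 0 < Cmod z) by now apply Cmod_gt_0.
assert (NK := Cmod_ge_0 K).
(* This threshold makes s^(c+1) (|K| + 1) B |z|, a bound for |Phi(s)|, smaller than eps; it exists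
   because c + 1 > 0. *)
destruct (Rpower_small (c + 1) (eps / ((Cmod K + 1) * B * Cmod z))) as [d2 [Hd2 HR]].
{ lra. }
{ apply Rdiv_lt_0_compat; [apply cond_pos|]. repeat apply Rmult_lt_0_compat; lra. }
pose (d := Rmin 1 (Rmin (d1 / Cmod z) d2)).
assert (Hd : 0 < d).
{ unfold d. repeat apply Rmin_pos; try lra. apply Rdiv_lt_0_compat; lra. }
(* The lower limit ranges over (0, d) and the upper one is exactly 1. As Phi(1) = K G(z), the
   integral from s misses the limit by Phi(s). *)
exists (fun s => 0 < s < d) (fun t => t = 1); [|reflexivity|].
- exists (mkposreal d Hd). intros s Hs Hs0.
  change (Rabs (s - 0) < d) in Hs. rewrite Rminus_0_r, Rabs_pos_eq in Hs; lra.
- intros s t Hs ->. cbn [fst snd].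
  assert (s1 : s < 1) by (apply Rlt_le_trans with (1 := proj2 Hs); apply Rmin_l).
  assert (s2 : s < d1 / Cmod z).
  { apply Rlt_le_trans with (1 := proj2 Hs).
    apply Rle_trans with (1 := Rmin_r _ _). apply Rmin_l. }
  assert (s3 : s < d2).
  { apply Rlt_le_trans with (1 := proj2 Hs).
    apply Rle_trans with (1 := Rmin_r _ _). apply Rmin_r. }
  exists (minus (G := C_R_NormedModule) (Phi 1) (Phi s)). split.
  + apply (is_RInt_ext (V := C_R_NormedModule) phi).
    { intros t Ht. rewrite Rmin_left in Ht by lra.
      unfold phi. rewrite Crpow_Rmult by (exact Hz0 || lra). fold K. C_eq. ring. }
    apply (is_RInt_derive (V := C_R_CompleteNormedModule) Phi phi);
      intros t Ht; rewrite Rmin_left, Rmax_right in Ht by lra;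
      [apply HPhi | apply Hphi]; lra.
  + apply HP.
    change (Cmod (Phi 1 - Phi s - K * G z) < eps).
    replace (Phi 1 - Phi s - K * G z)%C with (- Phi s)%C.
    2:{ assert (E1 : Rpower 1 c = 1) by (unfold Rpower; rewrite ln_1, Rmult_0_r; apply exp_0).
      unfold Phi. rewrite E1, !Cmult_1_l. ring. }
    rewrite Cmod_opp. unfold Phi. rewrite !Cmod_mult, Cmod_R, Rabs_pos_eq
      by apply Rlt_le, exp_pos.
    specialize (HL (RtoC s * z)%C).
    replace (RtoC s * z - 0)%C with (RtoC s * z)%C in HL by ring.
    rewrite HG0, Cmod_mult, Cmod_R, Rabs_pos_eq in HL by lra.
    replace (G (RtoC s * z) - 0)%C with (G (RtoC s * z)%C) in HL by ring.
    apply Rlt_div_r in s2; [|exact Nz]. specialize (HL s2).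
    specialize (HR s ltac:(lra)).
    rewrite Rpower_plus, Rpower_1 in HR by lra.
    apply Rlt_div_r in HR; [|repeat apply Rmult_lt_0_compat; lra].
    assert (HE := exp_pos (c * ln s)). fold (Rpower s c) in HE.
    apply Rle_lt_trans with (2 := HR).
    replace (Rpower s c * s * ((Cmod K + 1) * B * Cmod z))
      with (Rpower s c * ((Cmod K + 1) * (B * (s * Cmod z)))) by ring.
    apply Rmult_le_compat_l; [lra|].
    apply Rmult_le_compat; try lra. apply Cmod_ge_0.
Qed.

(** Index 0 is bounded on its own, since c may be zero or negative; for k >= 1 one has c + k >= c +
    1 > 0. *)
Lemma subexponential_bernardi (c : R) : c > -1 ->
  subexponential (fun k => RtoC (/ (c + INR k))).
Proof.
intros Hc. apply (subexponential_bounded _ (Rabs (/ c) + / (c + 1))).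
intros k. rewrite Cmod_R.
assert (H1 : 0 < / (c + 1)) by (apply Rinv_0_lt_compat; lra).
destruct k as [|k].
- cbn [INR]. rewrite Rplus_0_r. lra.
- assert (Hk := pos_INR k). rewrite S_INR.
  assert (H2 : / (c + (INR k + 1)) <= / (c + 1)) by (apply Rinv_le_contravar; lra).
  assert (H3 : 0 < / (c + (INR k + 1))) by (apply Rinv_0_lt_compat; lra).
  rewrite (Rabs_pos_eq (/ (c + (INR k + 1)))) by lra.
  assert (H4 := Rabs_pos (/ c)). lra.
Qed.

(** The series G with coefficients a_k/(c + k) solves cG + wG' = f, so the integral equals z^c G(z).
    At k = 0 the relation holds because a_0 = 0, even when c = 0. *)
Lemma expands_bernardi (c : R) (a : nat -> C) (f : C -> C) :
  c > -1 -> a 0%nat = 0%C -> expands a f ->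
  expands (fun k => RtoC ((c + 1) / (c + INR k)) * a k)%C (bernardi c f).
Proof.
intros Hc Ha0 Hf z Hz.
assert (Ha := expands_subexponential a f Hf).
pose (b := fun k => (RtoC (/ (c + INR k)) * a k)%C).
assert (Hb : subexponential b).
{ apply subexponential_mult; [now apply subexponential_bernardi|exact Ha]. }
replace (bernardi c f z) with (RtoC (c + 1) * psum b z)%C.
{ assert (H := is_series_scal (V := C_NormedModule) (RtoC (c + 1)) _ _
    (psum_correct b z Hb Hz)).
  revert H. apply (is_series_ext (V := C_NormedModule)). intros k. C_eq.
  change (RtoC (c + 1) * (pow_n (K := C_AbsRing) z k * (RtoC (/ (c + INR k)) * a k))
   = pow_n (K := C_AbsRing) z k * (RtoC ((c + 1) / (c + INR k)) * a k))%C.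
  unfold Rdiv. rewrite RtoC_mult. ring. }
assert (Hb0 : psum b 0%C = 0%C).
{ rewrite psum_at_0. unfold b. rewrite Ha0. ring. }
destruct (Req_dec (Cmod z) 0) as [Hz0|Hz0].
{ apply Cmod_eq_0 in Hz0. subst z. rewrite Hb0.
  unfold bernardi, seg_integral. ring. }
assert (Hzn : z <> 0%C) by (intros ->; now rewrite Cmod_0 in Hz0).
unfold bernardi.
rewrite (seg_integral_Crpow c f (psum b) (psum (diff_coef b))); auto.
- field. apply Crpow_neq_0.
- intros w Hw. now apply psum_derive.
- intros w Hw. exists (psum (diff_coef a) w).
  (* f equals its series only on the unit disk, so the derivative is transferred through a ball
     inside it. *)
  apply (is_derive_ext_loc (K := C_AbsRing) (V := C_NormedModule) (psum a)).
  2:{ now apply psum_derive. }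
  unfold in_E in Hw. assert (Hd : 0 < 1 - Cmod w) by lra.
  exists (mkposreal _ Hd). intros v Hv.
  change (Cmod (v - w) < 1 - Cmod w) in Hv.
  assert (T := Cmod_sub_triangle v w).
  symmetry. apply expands_eq_psum; [exact Hf|]. unfold in_E; lra.
- intros w Hw. rewrite (expands_eq_psum a f w Hf Hw).
  rewrite (psum_euler c 1 a b w Ha Hb Hw); [ring|].
  intros k. unfold b. destruct k as [|k]; [rewrite Ha0; ring|].
  assert (Hk := pos_INR k). rewrite Cmult_assoc, <- RtoC_mult, Rinv_r; [ring|].
  rewrite S_INR. lra.
Qed.

(** * The operators L_n *)

(* coefficients of L_n^sigma f(z) / z *)
Definition L_coef (n : nat) (sigma : R) (a : nat -> C) : nat -> C :=
  shift (fun k => RtoC (INR k ^ n * Rpower (2 / (INR k + 1)) sigma) * a k)%C.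

Lemma subexponential_L_weight (n : nat) (sigma : R) (a : nat -> C) :
  subexponential a ->
  subexponential
    (fun k => RtoC (INR k ^ n * Rpower (2 / (INR k + 1)) sigma) * a k)%C.
Proof.
intros Ha. apply subexponential_mult; [|exact Ha].
intros rho Hrho.
destruct (subexponential_mult _ _ (subexponential_pow _ n subexponential_INR)
  (subexponential_Rpower sigma) rho Hrho) as [M HM].
exists M; intros k. now rewrite RtoC_mult.
Qed.

Lemma subexponential_L_coef (n : nat) (sigma : R) (a : nat -> C) :
  subexponential a -> subexponential (L_coef n sigma a).
Proof. intros Ha. now apply subexponential_shift, subexponential_L_weight. Qed.

Lemma L_eq_psum (n : nat) (sigma : R) (a : nat -> C) (f : C -> C) (z : C) :
  a 0%nat = 0%C -> expands a f -> in_E z ->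
  L n sigma f z = (z * psum (L_coef n sigma a) z)%C.
Proof.
intros Ha0 Hf Hz.
assert (Ha := subexponential_L_weight n sigma a (expands_subexponential a f Hf)).
transitivity
  (psum (fun k => RtoC (INR k ^ n * Rpower (2 / (INR k + 1)) sigma) * a k)%C z).
- apply psum_ext; [|exact Ha|exact Hz].
  intros k. now rewrite (expands_coef a f Hf).
- rewrite psum_shift by assumption. rewrite Ha0. fold (L_coef n sigma a). ring.
Qed.

Lemma psum_L_coef_at_0 (n : nat) (sigma : R) (a : nat -> C) :
  a 1%nat = 1%C -> psum (L_coef n sigma a) 0%C = 1%C.
Proof.
intros Ha1. rewrite psum_at_0. unfold L_coef, shift. rewrite Ha1. cbn [INR].
replace (2 / (1 + 1)) with 1 by field.
unfold Rpower. rewrite ln_1, Rmult_0_r, exp_0, pow1.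
rewrite Rmult_1_l. ring.
Qed.

Lemma L_coef_succ (n : nat) (sigma : R) (a : nat -> C) (k : nat) :
  L_coef (S n) sigma a k = (RtoC (1 + INR k) * L_coef n sigma a k)%C.
Proof.
unfold L_coef, shift. rewrite S_INR. cbn [pow]. rewrite !RtoC_mult, Rplus_comm. ring.
Qed.

(** The Salagean step: with L_n f = zP, the next operator is z (zP)' = z (P + zP'). *)
Lemma psum_L_coef_succ (n : nat) (sigma : R) (a : nat -> C) (z : C) :
  subexponential a -> in_E z ->
  psum (L_coef (S n) sigma a) z
  = (psum (L_coef n sigma a) z + z * psum (diff_coef (L_coef n sigma a)) z)%C.
Proof.
intros Ha Hz.
assert (E := psum_euler 1 1 (L_coef (S n) sigma a) (L_coef n sigma a) z
  (subexponential_L_coef _ _ _ Ha) (subexponential_L_coef _ _ _ Ha) Hz).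
rewrite !Cmult_1_l in E. symmetry. apply E.
intros k. rewrite L_coef_succ. ring.
Qed.

Definition bernardi_coef (c : R) (a : nat -> C) (k : nat) : C :=
  (RtoC ((c + 1) / (c + INR k)) * a k)%C.

(** After the shift, index k carries the multiplier (c+1)/(c+1+k), and the Euler operator c + 1 + z
    d/dz multiplies it by c+1+k. *)
Lemma psum_L_coef_bernardi (n : nat) (sigma c : R) (a : nat -> C) (z : C) :
  c > -1 -> subexponential a -> subexponential (bernardi_coef c a) -> in_E z ->
  (RtoC (c + 1) * psum (L_coef n sigma (bernardi_coef c a)) z
   + z * psum (diff_coef (L_coef n sigma (bernardi_coef c a))) z
   = RtoC (c + 1) * psum (L_coef n sigma a) z)%C.
Proof.
intros Hc Ha Hb Hz.
apply psum_euler; [now apply subexponential_L_coef..|exact Hz|].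
intros k. unfold L_coef, shift, bernardi_coef.
assert (Hk := pos_INR k).
replace (RtoC (c + 1)) with (RtoC (c + 1 + INR k) * RtoC ((c + 1) / (c + INR (S k))))%C
  by (rewrite S_INR, <- RtoC_mult; f_equal; field; lra).
ring.
Qed.

Lemma class_A_bernardi (c : R) (a : nat -> C) (f : C -> C) : c > -1 ->
  a 0%nat = RtoC 0 -> a 1%nat = RtoC 1 -> expands a f ->
  bernardi_coef c a 0%nat = RtoC 0 /\ bernardi_coef c a 1%nat = RtoC 1 /\
  expands (bernardi_coef c a) (bernardi c f).
Proof.
intros Hc Ha0 Ha1 Hf. unfold bernardi_coef. repeat split.
- rewrite Ha0. ring.
- rewrite Ha1. cbn [INR]. replace ((c + 1) / (c + 1)) with 1 by (field; lra). ring.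
- now apply expands_bernardi.
Qed.

(** Cancelling the common factor z removes the singularity at the origin, and the nonvanishing
    denominator makes the result differentiable on the whole disk. *)
Lemma is_quotient_L (n m : nat) (sigma : R) (a b : nat -> C) (f g : C -> C) :
  a 0%nat = 0%C -> b 0%nat = 0%C -> expands a f -> expands b g ->
  (forall z : C, in_E z -> psum (L_coef m sigma b) z <> 0%C) ->
  is_quotient (L n sigma f) (L m sigma g)
    (fun z => psum (L_coef n sigma a) z / psum (L_coef m sigma b) z)%C.
Proof.
intros Ha0 Hb0 Hf Hg Hn.
assert (Ha := expands_subexponential a f Hf).
assert (Hb := expands_subexponential b g Hg).
split.
- intros z Hz. eexists. apply is_Cderive_div.
  + apply psum_derive; [now apply subexponential_L_coef|exact Hz].
  + apply psum_derive; [now apply subexponential_L_coef|exact Hz].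
  + now apply Hn.
- intros z Hz HL. specialize (Hn z Hz).
  rewrite (L_eq_psum m sigma b g z Hb0 Hg Hz) in *.
  rewrite (L_eq_psum n sigma a f z Ha0 Hf Hz).
  assert (Hz0 : z <> 0%C) by (intros ->; apply HL; ring).
  field. auto.
Qed.

Theorem theorem6 (n : nat) (sigma beta gamma c : R)
  (hbeta : 0 <= beta) (hbeta1 : beta <> 1)
  (hgamma : 0 <= gamma < 1)
  (hc : c > -1) (hcg : c + gamma > 0)
  (f : C -> C) (hf : class_K n sigma beta gamma f) :
  class_K n sigma beta gamma (bernardi c f).
Proof.
destruct hf as [[a [Ha0 [Ha1 Hf]]]
  [g [[[b [Hb0 [Hb1 Hg]]] [h [[_ Hh] Hsim]]] [K [[_ HK] HKsim]]]]].
destruct (class_A_bernardi c a f hc Ha0 Ha1 Hf) as [Ha0' [Ha1' Hf']].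
destruct (class_A_bernardi c b g hc Hb0 Hb1 Hg) as [Hb0' [Hb1' Hg']].
assert (Sa := expands_subexponential _ _ Hf).
assert (Sb := expands_subexponential _ _ Hg).
assert (Sa' := expands_subexponential _ _ Hf').
assert (Sb' := expands_subexponential _ _ Hg').
set (P := psum (L_coef n sigma b)).
set (Q := psum (L_coef n sigma (bernardi_coef c b))).
set (U := psum (L_coef (S n) sigma (bernardi_coef c a))).
set (V := psum (L_coef (S n) sigma a)).
pose (dP := psum (diff_coef (L_coef n sigma b))).
pose (dQ := psum (diff_coef (L_coef n sigma (bernardi_coef c b)))).
pose (dU := psum (diff_coef (L_coef (S n) sigma (bernardi_coef c a)))).
assert (HdP : forall z, in_E z -> is_Cderive P z (dP z)).
{ intros z Hz. now apply psum_derive; [apply subexponential_L_coef|]. }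
assert (HdQ : forall z, in_E z -> is_Cderive Q z (dQ z)).
{ intros z Hz. now apply psum_derive; [apply subexponential_L_coef|]. }
assert (HdU : forall z, in_E z -> is_Cderive U z (dU z)).
{ intros z Hz. now apply psum_derive; [apply subexponential_L_coef|]. }
assert (HP0 : P 0%C = 1%C) by now apply psum_L_coef_at_0.
assert (HQ0 : Q 0%C = 1%C) by now apply psum_L_coef_at_0.
assert (HU0 : U 0%C = 1%C) by now apply psum_L_coef_at_0.
assert (HQP : forall z, in_E z ->
  (RtoC (c + 1) * Q z + z * dQ z = RtoC (c + 1) * P z)%C).
{ intros z Hz. now apply psum_L_coef_bernardi. }
assert (HUV : forall z, in_E z ->
  (RtoC (c + 1) * U z + z * dU z = RtoC (c + 1) * V z)%C).
{ intros z Hz. now apply psum_L_coef_bernardi. }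
assert (Hgamma : forall z, in_E z -> gamma < Re (h z)).
{ intros z Hz. destruct (Hsim z Hz) as [[_ H]|[H _]]; lra. }
assert (HhP : forall z, in_E z -> z <> 0%C -> P z <> 0%C ->
  (h z * P z = P z + z * dP z)%C).
{ intros z Hz Hz0 HPz. specialize (Hh z Hz).
  rewrite (L_eq_psum (S n) sigma b g), (L_eq_psum n sigma b g) in Hh by assumption.
  rewrite psum_L_coef_succ in Hh by assumption. fold P dP in Hh.
  rewrite Hh; [field; auto|]. now apply Cmult_neq_0. }
assert (HPn : forall z, in_E z -> P z <> 0%C).
{ apply (starlike_nonvanishing P dP h HdP HP0 HhP).
  intros z Hz. specialize (Hgamma z Hz). lra. }
assert (HKP : forall z, in_E z -> z <> 0%C -> (K z * P z = V z)%C).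
{ intros z Hz Hz0. specialize (HK z Hz). specialize (HPn z Hz).
  rewrite (L_eq_psum (S n) sigma a f), (L_eq_psum n sigma b g) in HK by assumption.
  fold P V in HK. rewrite HK; [field; auto|]. now apply Cmult_neq_0. }
assert (HQ : forall z, in_E z ->
  Q z <> 0%C /\ 0 <= Re (Q z / P z)%C /\ (c + gamma) / (c + 1) < Re (P z / Q z)%C).
(* With k = (c + gamma)/(c + 1), the number 1/(2k) is both centre and radius of the disk confining
   Q/P. *)
{ intros z Hz. apply Re_div_gt; [apply Rdiv_lt_0_compat; lra| |now apply HPn].
  apply (bernardi_ratio_in_disk c gamma P dP Q dQ h); auto; lra. }
assert (HQn : forall z, in_E z -> Q z <> 0%C) by (intros z Hz; now apply HQ).
split; [now exists (bernardi_coef c a)|].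
exists (bernardi c g); split; [split; [now exists (bernardi_coef c b)|]|].
- eexists; split.
  { apply (is_quotient_L (S n) n sigma (bernardi_coef c b) (bernardi_coef c b)); auto. }
  intros z Hz; cbv beta. left; split; [exact hgamma|].
  rewrite psum_L_coef_succ by assumption. fold Q dQ.
  destruct (HQ z Hz) as [Hne [_ HRe]].
  replace ((Q z + z * dQ z) / Q z)%C with (RtoC (c + 1) * (P z / Q z) - RtoC c)%C.
  2:{ replace (z * dQ z)%C with (RtoC (c + 1) * P z - RtoC (c + 1) * Q z)%C
        by (rewrite <- HQP by exact Hz; ring).
      rewrite RtoC_plus. field. exact Hne. }
  apply Rlt_div_l in HRe; [|lra].
  unfold Re in *; cbn in *. lra.
- eexists; split.
  { apply (is_quotient_L (S n) n sigma (bernardi_coef c a) (bernardi_coef c b)); auto. }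
  intros z Hz; cbv beta. fold U Q.
  (* Applied with s = 1 for beta < 1 and s = -1 for beta > 1; s (1 - beta) > 0 is the required
     inequality at the origin, where U/Q = 1. *)
  assert (Hsign : forall s, (forall w, in_E w -> 0 < s * (Re (K w) - beta)) ->
    0 < s * (1 - beta) -> 0 < s * (Re (U z / Q z)%C - beta)).
  { intros s Hs Hs1.
    apply (bernardi_quotient_sign c beta s P Q dQ U dU V K); auto.
    intros w Hw. now apply HQ. }
  destruct (Rlt_le_dec beta 1) as [Hlt|Hge].
  + left. split; [lra|]. specialize (Hsign 1).
    enough (0 < 1 * (Re (U z / Q z)%C - beta)) by lra.
    apply Hsign; [|lra]. intros w Hw. destruct (HKsim w Hw) as [H|H]; lra.
  + right. split; [lra|].
    enough (0 < -1 * (Re (U z / Q z)%C - beta)) by lra.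
    apply Hsign; [|lra]. intros w Hw. destruct (HKsim w Hw) as [H|H]; lra.
Qed.
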